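(* Let $\mathcal U_{i_0}$ ($1\le i_0\le n$) be the affine charts of the splitting model ${\rm M}^{\rm spl}_I$ (signature $(n-1,1)$, $I=\{\ell\}$ strongly non-special) defined in the context. Let $V_1=[v_1\ \cdots\ v_{2\ell}]^t$, $V_2=[v_{2\ell+1}\ \cdots\ v_n]^t$, $Z_2=[z_{2\ell+1}\ \cdots\ z_n]^t$ be column matrices of indeterminates, $u$ an indeterminate, and $H$ the unit anti-diagonal matrix of size $n-2\ell$. (1) For $1\le i_0\le2\ell$, the affine chart $\mathcal U_{i_0}$ is isomorphic to $${\rm Spec}\,\frac{O_F[V_1,V_2,Z_2]}{(v_{i_0}-1,\ \wedge^2[\,V_2\mid HZ_2\,],\ Z_2^t\cdot V_2-2\pi)}.$$ (2) For $2\ell+1\le i_0\le n$, the affine chart $\mathcal U_{i_0}$ is isomorphic to $${\rm Spec}\,\frac{O_F[V_1,V_2,u]}{(v_{i_0}-1,\ u\cdot(V_2^tHV_2)-2\pi)}.$$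
   Context: $\wedge^2[\,A\mid B\,]$ denotes the set of all $2\times2$ minors of the two-column matrix $[A\mid B]$. Let $F_0$ be a complete discretely valued field with ring of integers $O_{F_0}$, perfect residue field $k$ of characteristic $\ne2$ and uniformizer $\pi_0$; $F/F_0$ a ramified quadratic extension with uniformizer $\pi$, $\pi^2=\pi_0$, ring of integers $O_F$, and $a\mapsto\bar a$ the nontrivial element of ${\rm Gal}(F/F_0)$. Let $V$ be an $F$-vector space of dimension $n>3$ with an $F/F_0$-hermitian form $\phi$ which is split: there is a basis $e_1,\dots,e_n$ with $\phi(ae_i,be_{n+1-j})=\bar ab\,\delta_{i,j}$ for $a,b\in F$. Put $(x,y)=\frac12{\rm Tr}_{F/F_0}(\phi(x,y))$. For $0\le i\le n-1$ let $\Lambda_i={\rm span}_{O_F}\{\pi^{-1}e_1,\dots,\pi^{-1}e_i,e_{i+1},\dots,e_n\}$. Let $m=\lfloor n/2\rfloor$ and let $I=\{\ell\}$ be strongly non-special: $0\le\ell\le m$, with $\ell\ne0,m-1,m$ if $n=2m$, and $\ell\ne0,m$ if $n=2m+1$. The form $(\,,\,)$ induces a perfect pairing $\Lambda_{n-\ell}\times\Lambda_\ell\to O_{F_0}$. Let $t$ denote multiplication by $\pi\in O_F$ on the lattices. For an $O_F$-scheme $S$, $\Lambda_j\otimes\mathcal O_S$ means $\Lambda_j\otimes_{O_{F_0}}\mathcal O_S$, on which $\pi$ acts through $\mathcal O_S$. ${\rm M}^{\rm naive}_I$ is the projective $O_F$-scheme whose $S$-points are pairs of $O_F\otimes\mathcal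 O_S$-submodules $\mathcal F_\ell\subset\Lambda_\ell\otimes\mathcal O_S$, $\mathcal F_{n-\ell}\subset\Lambda_{n-\ell}\otimes\mathcal O_S$ such that (1) both are Zariski locally $\mathcal O_S$-direct summands of rank $n$; (2) the maps induced by $\Lambda_\ell\subset\Lambda_{n-\ell}\subset\pi^{-1}\Lambda_\ell$ restrict to $\mathcal F_\ell\to\mathcal F_{n-\ell}\to\pi^{-1}\mathcal F_\ell$; (3) $\mathcal F_{n-\ell}$ is the orthogonal complement of $\mathcal F_\ell$ under $(\,,\,)$; (4) $t$ has characteristic polynomial $(T+\pi)^{n-1}(T-\pi)$ on $\mathcal F_\ell$ and on $\mathcal F_{n-\ell}$. ${\rm M}^\wedge_I\subset{\rm M}^{\rm naive}_I$ is the closed subscheme where moreover $\wedge^n(t-\pi\mid\mathcal F_\kappa)=0$ and $\wedge^2(t+\pi\mid\mathcal F_\kappa)=0$ for $\kappa=\ell,n-\ell$. The splitting model ${\rm M}^{\rm spl}_I$ is the projective $O_F$-scheme whose $S$-points are triples $(\mathcal F_\ell,\mathcal F_{n-\ell},\mathcal G_{n-\ell})$ with $(\mathcal F_\ell,\mathcal F_{n-\ell})\in{\rm M}^\wedge_I(S)$ and $\mathcal G_{n-\ell}\subset\mathcal F_{n-\ell}$ Zariski locally an $\mathcal O_S$-direct summand of rank $1$ such that $(t+\pi)\mathcal F_{n-\ell}\subset\mathcal G_{n-\ell}$ and $(t-\pi)\mathcal G_{n-\ell}=0$. **Charts.** Use the ordered $O_{F_0}$-bases $\Lambda_\ell$: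 $e_{n-\ell+1},\dots,e_n,\ \pi^{-1}e_1,\dots,\pi^{-1}e_\ell,\ e_{\ell+1},\dots,e_{n-\ell}$, followed by $\pi$ times these $n$ vectors in the same order; $\Lambda_{n-\ell}$: $e_{n-\ell+1},\dots,e_n,\ \pi^{-1}e_1,\dots,\pi^{-1}e_\ell,\ \pi^{-1}e_{\ell+1},\dots,\pi^{-1}e_{n-\ell}$, followed by $\pi$ times these $n$ vectors in the same order. $\mathcal U_{i_0}$ is the open subscheme of ${\rm M}^{\rm spl}_I$ of points for which, in these bases, $\mathcal F_\ell$ and $\mathcal F_{n-\ell}$ are the column spans of $\begin{bmatrix}X\\ I_n\end{bmatrix}$ and $\begin{bmatrix}Y\\ I_n\end{bmatrix}$ with $X,Y$ of size $n\times n$, and $\mathcal G_{n-\ell}$ is spanned by a column $\begin{bmatrix}G_1\\ G_2\end{bmatrix}$ ($G_1,G_2$ of size $n\times1$) whose $G_2$-part has its $i_0$-th entry invertible (normalized to $1$). It is an affine neighborhood of the point $(t\Lambda_\ell,t\Lambda_{n-\ell},k\{\pi e_{n-\ell+i_0}\})$ if $1\le i_0\le\ell$, and of $(t\Lambda_\ell,t\Lambda_{n-\ell},k\{e_{-\ell+i_0}\})$ if $\ell+1\le i_0\le n$. *)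

(* Defs.v *)
From HB Require Import structures.
From mathcomp Require Import all_boot all_order all_algebra all_field.
From mathcomp Require Import boolp.
From mathcomp Require Import mpoly.
From mathcomp Require Import zify.

Set Implicit Arguments.
Unset Strict Implicit.
Unset Printing Implicit Defensive.

Import Order.TTheory GRing.Theory Num.Theory.
Local Open Scope ring_scope.
Local Open Scope quotient_scope.

(** * Discretely valued fields *)

(* Normalized discrete valuations.  The value at 0 is irrelevant: every
   condition, here and below, concerns nonzero arguments. *)
Record valuation (K : fieldType) := Valuation {
  valuation_fun :> K -> int;
  valuationM : forall x y, x != 0 -> y != 0 ->
    valuation_fun (x * y) = valuation_fun x + valuation_fun y;
  valuationD : forall x y, x != 0 -> y != 0 -> x + y != 0 ->
    Num.min (valuation_fun x) (valuation_fun y) <= valuation_fun (x + y);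
  valuation_onto : exists2 x, x != 0 & valuation_fun x = 1 }.

Section Valuation.

Variables (K : fieldType) (v : valuation K).

Definition uniformizer (x : K) : Prop := x != 0 /\ v x = 1.

Definition vclose (N : int) (x y : K) : bool := (x == y) || (N <= v (x - y)).

Definition complete_valuation : Prop :=
  forall u : nat -> K,
    (forall N : int, exists M : nat, forall p q : nat,
       (M <= p)%N -> (M <= q)%N -> vclose N (u p) (u q)) ->
    exists x : K, forall N : int, exists M : nat, forall p : nat,
       (M <= p)%N -> vclose N (u p) x.

Definition vintegral : {pred K} := [pred x | (x == 0) || (0 <= v x)].

Lemma valuation1 : v 1 = 0.
Proof.
have := valuationM v (oner_neq0 K) (oner_neq0 K).
by rewrite mulr1 => /eqP; rewrite eq_sym -subr_eq0 addrK => /eqP.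
Qed.

Lemma valuationN x : x != 0 -> v (- x) = v x.
Proof.
move=> x0; have n1 : (-1 : K) != 0 by rewrite oppr_eq0 oner_neq0.
have /eqP := valuationM v n1 n1.
rewrite mulrNN mulr1 valuation1 eq_sym -mulr2n mulrn_eq0 /= => /eqP vN1.
by rewrite -mulN1r (valuationM v) // vN1 add0r.
Qed.

Lemma vintegral_subring : subring_closed vintegral.
Proof.
split=> [|x y|x y]; rewrite !inE.
- by rewrite valuation1 lexx orbT.
- have [->|x0] := eqVneq x 0; have [->|y0] := eqVneq y 0 => //=.
  + by rewrite subr0 eqxx.
  + by rewrite sub0r valuationN // => _ ->; rewrite orbT.
  + by rewrite subr0 => ->; rewrite orbT.
  + move=> vx vy; have [//|xy0] /= := eqVneq (x - y) 0.
    have ny0 : - y != 0 by rewrite oppr_eq0.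
    apply: le_trans (valuationD v x0 ny0 xy0).
    by rewrite le_min valuationN // vx vy.
- have [->|x0] := eqVneq x 0; first by rewrite mul0r eqxx.
  have [->|y0] := eqVneq y 0; first by rewrite mulr0 eqxx.
  by rewrite /= (valuationM v) // => vx vy; rewrite addr_ge0 ?orbT.
Qed.

HB.instance Definition _ :=
  GRing.isSubringClosed.Build K vintegral vintegral_subring.

Record integers : Type :=
  Integers { integers_val : K; _ : integers_val \in vintegral }.

HB.instance Definition _ := [isSub for integers_val].
HB.instance Definition _ := [Choice of integers by <:].
HB.instance Definition _ := [SubChoice_isSubComNzRing of integers by <:].

(* Only meaningful on integral elements: the others are sent to 0. *)
Definition to_integers (x : K) : integers := insubd 0 x.

(* [red] exhibits [k] as the residue field: it is onto, and its kernel is the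
   maximal ideal. *)
Definition residue_map (k : fieldType) (red : {rmorphism integers -> k}) : Prop :=
  (forall c, exists x, red x = c) /\
  (forall x, red x = 0 <-> (\val x == 0) || (0 < v (\val x))).

End Valuation.

Definition perfect_field (k : fieldType) : Prop :=
  forall p : nat, p \in [pchar k] -> forall x : k, exists y : k, y ^+ p = x.

(** * Submodules of [R^m], as predicates on column vectors *)

Section Submodules.

Variables (R : comNzRingType) (m : nat).
Implicit Types (M N C : 'cV[R]_m -> Prop).

Definition submodule N : Prop :=
  N 0 /\ forall (a : R) x y, N x -> N y -> N (a *: x + y).

Definition whole : 'cV[R]_m -> Prop := fun=> True.

Definition colspan r (B : 'M[R]_(m, r)) : 'cV[R]_m -> Prop :=
  fun x => exists c : 'cV[R]_r, x = B *m c.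

(* The columns of [B] form a basis of [N]. *)
Definition col_basis r (B : 'M[R]_(m, r)) N : Prop :=
  (forall x, N x <-> colspan B x) /\ (forall c : 'cV[R]_r, B *m c = 0 -> c = 0).

Definition direct_summand M N : Prop :=
  (forall x, N x -> M x) /\
  exists C, [/\ submodule C, forall x, C x -> M x,
    forall x, M x -> exists y z, [/\ N y, C z & x = y + z] &
    forall x, N x -> C x -> x = 0].

End Submodules.

(* The submodule generated by the image of [N]; when [N] is a direct summand
   this is its base change along [f]. *)
Definition extend (R R' : comNzRingType) m (f : R -> R')
    (N : 'cV[R]_m -> Prop) : 'cV[R']_m -> Prop :=
  fun x => exists (s : nat) (a : 'I_s -> R') (y : 'I_s -> 'cV[R]_m),
    (forall i, N (y i)) /\ x = \sum_(i < s) a i *: map_mx f (y i).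

Definition is_localization (R R' : comNzRingType) (s : R)
    (f : {rmorphism R -> R'}) : Prop :=
  [/\ exists b, f s * b = 1,
      forall y, exists x k, y * f s ^+ k = f x &
      forall x, f x = 0 -> exists k, s ^+ k * x = 0].

(* The zero ring is not a [comNzRingType]: the localization at a nilpotent
   element imposes no condition. *)
Definition local_summand (R : comNzRingType) m (r : nat)
    (M N : 'cV[R]_m -> Prop) : Prop :=
  exists (d : nat) (s : 'I_d -> R),
    (exists c : 'I_d -> R, \sum_(i < d) c i * s i = 1) /\
    forall (i : 'I_d) (R' : comNzRingType) (f : {rmorphism R -> R'}),
      is_localization (s i) f ->
      direct_summand (extend f M) (extend f N) /\
      exists B : 'M[R']_(m, r), col_basis B (extend f N).

(* [h], which preserves the locally free module [N] of rank [r], has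
   characteristic polynomial [Q] on [N]: it does so wherever [N] has a basis. *)
Definition char_poly_on (R : comNzRingType) m (r : nat) (h : 'M[R]_m)
    (N : 'cV[R]_m -> Prop) (Q : {poly R}) : Prop :=
  forall (s : R) (R' : comNzRingType) (f : {rmorphism R -> R'}),
    is_localization s f ->
  forall (B : 'M[R']_(m, r)) (T : 'M[R']_r), col_basis B (extend f N) ->
    map_mx f h *m B = B *m T -> char_poly T = map_poly f Q.

(* The set of [k x k] minors, up to sign and with 0 added. *)
Definition minors (R : comNzRingType) p q (k : nat) (M : 'M[R]_(p, q)) : R -> Prop :=
  fun x => exists (f : 'I_k -> 'I_p) (g : 'I_k -> 'I_q), x = \det (mxsub f g M).

(* The map [/\^k N -> /\^k R^m] induced by [h] vanishes: the coordinates of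
   [h x_1 /\ ... /\ h x_k] are the minors of the matrix with columns [h x_j].
   If [N] is a locally direct summand stable under [h], then [/\^k N] is a
   submodule of [/\^k R^m], so that the endomorphism [/\^k (h | N)] is zero. *)
Definition wedge_zero (R : comNzRingType) m (k : nat) (h : 'M[R]_m)
    (N : 'cV[R]_m -> Prop) : Prop :=
  forall X : 'M[R]_(m, k), (forall j, N (col j X)) ->
  forall x, minors k (h *m X) x -> x = 0.

(** * The lattices *)

Definition hermitian_form (F0 : fieldType) (F : fieldExtType F0)
    (bar : 'AEnd(F)) (V : vectType F) (phi : V -> V -> F) : Prop :=
  (forall x a y z, phi x (a *: y + z) = a * phi x y + phi x z) /\
  (forall x y, phi y x = bar (phi x y)).

Definition split_basis (F0 : fieldType) (F : fieldExtType F0) (bar : 'AEnd(F))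
    (V : vectType F) (phi : V -> V -> F) n (e : n.-tuple V) : Prop :=
  basis_of {:V} e /\
  forall (i j : 'I_n) (a b : F),
    phi (a *: tnth e i) (b *: tnth e (rev_ord j)) = bar a * b * (i == j)%:R.

Definition strongly_nonspecial (n l : nat) : Prop :=
  [/\ (l <= n./2)%N, l != 0%N, l != n./2 & ~~ odd n -> l != (n./2).-1].

Section Lattices.

Variables (F0 : fieldType) (F : fieldExtType F0) (vF : valuation F) (pi : F).
Variables (bar : 'AEnd(F)) (n : nat) (V : vectType F) (phi : V -> V -> F).
Variables (e : n.-tuple V) (l : nat).

Local Notation OF := (integers vF).

Definition Lambda (i : nat) : V -> Prop := fun x =>
  exists c : 'I_n -> OF, x = \sum_(j < n) \val (c j) *:
    (if (j < i)%N then pi^-1 *: tnth e j else tnth e j).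

(* First halves of the ordered bases of [Lambda l] and [Lambda (n - l)],
   see [Lambda_l_basis] and [Lambda_nl_basis] below. *)
Definition half_l (a : 'I_n) : V :=
  if (a < l)%N then e`_(n - l + a)
  else if (a < 2 * l)%N then pi^-1 *: e`_(a - l)
  else e`_(a - l).

Definition half_nl (a : 'I_n) : V :=
  if (a < l)%N then e`_(n - l + a)
  else if (a < 2 * l)%N then pi^-1 *: e`_(a - l)
  else pi^-1 *: e`_(a - l).

(* From a basis over [O_F] to the ordered basis over [O_F0]. *)
Definition full (f : 'I_n -> V) (j : 'I_(n + n)) : V :=
  match split j with inl a => f a | inr a => pi *: f a end.

(* Coordinates over [F0] in the basis [full f], as [1, pi] is an [F0]-basis
   of [F]. *)
Definition coordinate (f : 'I_n -> V) (j : 'I_(n + n)) (x : V) : F0 :=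
  let c a := coord [tuple f b | b < n] a x in
  match split j with
  | inl a => coord [tuple 1; pi] 0 (c a)
  | inr a => coord [tuple 1; pi] 1 (c a)
  end.

(* A lattice [L] with [O_F0]-basis [full f] and an [O_F]-algebra [R] being
   given, the tensor product of [L] and [R] over [O_F0] is identified with
   [R^(2n)] through [full f]. An [O_F0]-linear map between two lattices then
   becomes the image in [R] of its matrix, which has entries in [O_F0]; here
   this matrix is given with entries in the larger ring [O_F]. *)
Definition lattice_mx (f g : 'I_n -> V) (h : V -> V) : 'M[OF]_(n + n) :=
  \matrix_(i, j) to_integers vF ((coordinate g i (h (full f j)))%:A).

Definition trace (a : F) : F0 := coord [tuple (1 : F)] 0 (a + bar a).

Definition bilin (x y : V) : F0 := 2%:R^-1 * trace (phi x y).

Definition gram : 'M[OF]_(n + n) :=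
  \matrix_(i, j) to_integers vF ((bilin (full half_nl i) (full half_l j))%:A).

Definition t_l : 'M[OF]_(n + n) := lattice_mx half_l half_l (fun x => pi *: x).
Definition t_nl : 'M[OF]_(n + n) := lattice_mx half_nl half_nl (fun x => pi *: x).

(* The inclusions of [Lambda l] in [Lambda (n - l)], and of [Lambda (n - l)]
   in [pi^-1 Lambda l]; the basis of the latter is [pi^-1] times that of
   [Lambda l], so that [F] and [pi^-1 F] have the same coordinates. *)
Definition incl_l_nl : 'M[OF]_(n + n) := lattice_mx half_l half_nl id.
Definition incl_nl_l : 'M[OF]_(n + n) :=
  lattice_mx half_nl (fun a => pi^-1 *: half_l a) id.

(** * The moduli problems, on [O_F]-algebras *)

Section Points.

Variable R : comAlgType OF.

Local Notation piR := ((to_integers vF pi)%:A : R).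
Local Notation "M ^R" := (map_mx (in_alg R) M) (at level 8, format "M ^R").
Implicit Types (Fl Fnl G : 'cV[R]_(n + n) -> Prop).

Definition naive_point Fl Fnl : Prop :=
  [/\ submodule Fl /\ submodule Fnl,
      (forall x, Fl x -> Fl (t_l^R *m x)) /\
      (forall x, Fnl x -> Fnl (t_nl^R *m x)),
      local_summand n (@whole R (n + n)) Fl /\
      local_summand n (@whole R (n + n)) Fnl &
      [/\ (forall x, Fl x -> Fnl (incl_l_nl^R *m x)) /\
          (forall x, Fnl x -> Fl (incl_nl_l^R *m x)),
          forall x, Fnl x <-> forall y, Fl y -> x^T *m gram^R *m y = 0,
          char_poly_on n t_l^R Fl (('X + piR%:P) ^+ n.-1 * ('X - piR%:P)) &
          char_poly_on n t_nl^R Fnl (('X + piR%:P) ^+ n.-1 * ('X - piR%:P))]].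

Definition wedge_point Fl Fnl : Prop :=
  [/\ naive_point Fl Fnl,
      wedge_zero n (t_l^R - piR%:M) Fl,
      wedge_zero 2 (t_l^R + piR%:M) Fl,
      wedge_zero n (t_nl^R - piR%:M) Fnl &
      wedge_zero 2 (t_nl^R + piR%:M) Fnl].

Definition splitting_point Fl Fnl G : Prop :=
  [/\ wedge_point Fl Fnl,
      submodule G,
      local_summand 1 Fnl G,
      forall x, Fnl x -> G ((t_nl^R + piR%:M) *m x) &
      forall x, G x -> (t_nl^R - piR%:M) *m x = 0].

(* On an affine base the matrices [X], [Y] and the normalized column are
   unique if they exist locally, hence they exist globally. *)
Definition chart_point (i0 : 'I_n) Fl Fnl G : Prop :=
  [/\ splitting_point Fl Fnl G,
      exists X : 'M[R]_n, forall x, Fl x <-> colspan (col_mx X 1%:M) x,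
      exists Y : 'M[R]_n, forall x, Fnl x <-> colspan (col_mx Y 1%:M) x &
      exists G1 G2 : 'cV[R]_n,
        G2 i0 0 = 1 /\ forall x, G x <-> colspan (col_mx G1 G2) x].

End Points.

End Lattices.

Section LatticeBases.

Variables (F0 : fieldType) (v0 : valuation F0).
Variables (F : fieldExtType F0) (vF : valuation F) (pi : F).
Hypothesis dimF : \dim {:F} = 2%N.
Hypothesis ramF : forall x : F0, x != 0 -> vF (x%:A) = 2 * v0 x.
Hypothesis hpi : uniformizer vF pi.
Variables (n : nat) (V : vectType F) (e : n.-tuple V) (l : nat).
Hypothesis he : basis_of {:V} e.
Hypothesis l_le : (l <= n./2)%N.

Local Notation OF := (integers vF).

Lemma valuation_pairE (a b : F0) : a != 0 -> b != 0 ->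
  (a%:A + b *: pi : F) != 0 /\ vF (a%:A + b *: pi) = Num.min (2 * v0 a) (2 * v0 b + 1).
Proof.
move=> a0 b0; have [pi0 vpi] := hpi.
have inj c : c != 0 -> (c%:A : F) != 0 by move=> ?; rewrite scaler_eq0 oner_eq0 orbF.
have vA := ramF a0.
have B0 : b *: pi != 0 by rewrite scaler_eq0 negb_or b0.
have vB : vF (b *: pi) = 2 * v0 b + 1.
  by rewrite -mulr_algl (valuationM vF) ?inj // ramF // vpi.
have A0 := inj _ a0.
have N0 : a%:A + b *: pi != 0.
  apply/eqP => /eqP; rewrite addr_eq0 => /eqP E.
  have := vA; rewrite E valuationN // vB => /eqP; lia.
split=> //.
have D (x y : F) : x != 0 -> y != 0 -> x + y != 0 -> vF x < vF y -> vF (x + y) = vF x.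
  move=> x0 y0 xy0 lt; apply/eqP; rewrite eq_le andbC.
  have := valuationD vF x0 y0 xy0; rewrite (min_idPl (ltW lt)) => -> /=.
  have ny0 : - y != 0 by rewrite oppr_eq0.
  have := valuationD vF xy0 ny0; rewrite addrK => /(_ x0).
  rewrite valuationN // ge_min => /orP[//|]; rewrite leNgt lt //.
rewrite -vA -vB.
have [lt|gt|E] := ltgtP (vF a%:A) (vF (b *: pi)).
- by rewrite D.
- by rewrite addrC D // addrC.
- by move: E; rewrite vA vB; lia.
Qed.

Lemma free_1pi : basis_of {:F} [tuple 1; pi].
Proof.
rewrite basisEfree subvf dimF /= andbT.
have [pi0 vpi] := hpi.
rewrite free_cons seq1_free pi0 andbT span_seq1; apply/vlineP => -[c E].
have c0 : c != 0 by apply: contra_eq_neq E => ->; rewrite scale0r oner_neq0.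
have Epi : pi = (c^-1)%:A by rewrite [X in _ *: X]E scalerA mulVf // scale1r.
have c'0 : - c^-1 != 0 by rewrite oppr_eq0 invr_eq0.
have [+ _] := valuation_pairE c'0 (oner_neq0 _).
by rewrite Epi scale1r scaleNr addNr eqxx.
Qed.

Lemma pair_coord (a : F) :
  a = (coord [tuple 1; pi] 0 a)%:A + coord [tuple 1; pi] 1 a *: pi.
Proof.
rewrite {1}(coord_basis free_1pi (memvf a)) big_ord_recl big_ord1 /=.
congr (_ + _ *: _); congr (coord _ _ _); exact: val_inj.
Qed.

Lemma vintegral_pair (a : F) :
  (a \in vintegral vF) = (coord [tuple 1; pi] 0 a \in vintegral v0) &&
                         (coord [tuple 1; pi] 1 a \in vintegral v0).
Proof.
have [pi0 vpi] := hpi.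
rewrite {1}(pair_coord a); move: (coord _ 0 a) (coord _ 1 a) => x y.
have inj c : c != 0 -> (c%:A : F) != 0 by move=> ?; rewrite scaler_eq0 oner_eq0 orbF.
rewrite !inE; have [->|x0] /= := eqVneq x 0; have [->|y0] /= := eqVneq y 0.
- by rewrite !scale0r addr0 eqxx.
- rewrite scale0r add0r scaler_eq0 (negPf y0) (negPf pi0) /=.
  by rewrite -mulr_algl (valuationM vF) ?inj // ramF // vpi; lia.
- rewrite scale0r addr0 (negPf (inj _ x0)) ramF // andbT; lia.
- have [/negPf -> ->] := valuation_pairE x0 y0; rewrite /= le_min; lia.
Qed.

Lemma full_basis (L : V -> Prop) (f : 'I_n -> V) :
    basis_of {:V} [tuple f a | a < n] ->
    (forall x, L x <-> exists c : 'I_n -> OF, x = \sum_a \val (c a) *: f a) ->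
  forall x, (L x <-> forall j, coordinate pi f j x \in vintegral v0) /\
    x = \sum_j (coordinate pi f j x)%:A *: full pi f j.
Proof.
move=> bf Lf x; pose c a := coord [tuple f b | b < n] a x.
have xE : x = \sum_a c a *: f a.
  rewrite {1}(coord_basis bf (memvf x)); apply: eq_bigr => a _.
  by rewrite -tnth_nth tnth_mktuple.
split; last first.
  rewrite big_split_ord /= {1}xE -big_split /=; apply: eq_bigr => a _.
  rewrite /coordinate /full (unsplitK (inl a)) (unsplitK (inr a)) -/(c a).
  by rewrite scalerA mulr_algl -scalerDl -pair_coord.
have cE : (forall a, c a \in vintegral vF) <->
          (forall j, coordinate pi f j x \in vintegral v0).
  split=> [cO j|cO a].
    by rewrite /coordinate; case: (split j) => a;
       have := cO a; rewrite vintegral_pair => /andP[].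
  rewrite vintegral_pair; apply/andP.
  have := cO (lshift n a); have := cO (rshift n a).
  by rewrite /coordinate (unsplitK (inl a)) (unsplitK (inr a)).
split=> [/Lf[b E]|/cE cO]; last first.
  apply/Lf; exists (fun a => Integers (cO a)); exact: xE.
apply/cE => a; rewrite /c E.
under eq_bigr => k _ do rewrite -[f k](tnth_mktuple f) (tnth_nth 0).
by rewrite (coord_sum_free _ _ (basis_free bf)); exact: valP.
Qed.

Local Notation gen i j :=
  (if (j < i)%N then pi^-1 *: tnth e j else tnth e j) (i in scope nat_scope, j in scope nat_scope).

Lemma halfE : exists s : 'I_n -> 'I_n, [/\ injective s,
  forall a, half_l pi e l a = gen l (s a) &
  forall a, half_nl pi e l a = gen (n - l) (s a)].
Proof.
have ltn a : (a < n)%N -> ((if a < l then n - l + a else a - l) < n)%N.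
  by have := l_le; have := odd_double_half n; case: ifP; lia.
exists (fun a : 'I_n => Ordinal (ltn a (ltn_ord a))); split=> [a b /(congr1 val)|a|a].
- move=> /= E; apply: val_inj => /=; move: E.
  have := l_le; have := odd_double_half n; have := ltn_ord a; have := ltn_ord b.
  by do 2 case: ifP; lia.
- rewrite /half_l !(tnth_nth 0) /=; have := ltn_ord a.
  have := l_le; have := odd_double_half n.
  by case: (ltnP a l) => al; case: (ltnP a (2 * l)) => al2; case: ifP => //; lia.
- rewrite /half_nl !(tnth_nth 0) /=; have := ltn_ord a.
  have := l_le; have := odd_double_half n.
  by case: (ltnP a l) => al; case: (ltnP a (2 * l)) => al2; case: ifP => //; lia.
Qed.

Lemma half_basis i (f : 'I_n -> V) (s : 'I_n -> 'I_n) :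
    injective s -> (forall a, f a = gen i (s a)) ->
  basis_of {:V} [tuple f a | a < n] /\
  forall x, Lambda vF pi e i x <-> exists c : 'I_n -> OF, x = \sum_a \val (c a) *: f a.
Proof.
move=> s_inj fE; have [pi0 _] := hpi; split.
  have dimV := vector.size_basis he.
  rewrite basisEdim size_tuple dimV leqnn andbT -(span_basis he); apply/span_subvP => v /tnthP[j ->].
  have [t ts st] := injF_bij s_inj.
  have : tnth e j = (if (j < i)%N then pi else 1) *: f (t j).
    by rewrite fE st; case: ifP => _; rewrite ?scale1r // scalerA divff // scale1r.
  move=> ->; apply: memvZ; apply: memv_span; apply/tnthP; exists (t j).
  by rewrite tnth_mktuple.
move=> x; have [t ts st] := injF_bij s_inj; split=> -[c ->].
  exists (c \o s); rewrite (reindex_inj s_inj); apply: eq_bigr => a _.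
  by rewrite fE.
exists (c \o t); rewrite [RHS](reindex_inj s_inj); apply: eq_bigr => a _ /=.
by rewrite fE ts.
Qed.

(* The [full half_l j] (resp. [full half_nl j]) form an [O_F0]-basis of
   [Lambda l] (resp. [Lambda (n - l)]). *)
Lemma Lambda_l_basis x :
  (Lambda vF pi e l x <-> forall j, coordinate pi (half_l pi e l) j x \in vintegral v0) /\
  x = \sum_j (coordinate pi (half_l pi e l) j x)%:A *: full pi (half_l pi e l) j.
Proof.
have [s [s_inj fE _]] := halfE.
by have [b L] := half_basis s_inj fE; exact: full_basis b L x.
Qed.

Lemma Lambda_nl_basis x :
  (Lambda vF pi e (n - l) x <->
     forall j, coordinate pi (half_nl pi e l) j x \in vintegral v0) /\
  x = \sum_j (coordinate pi (half_nl pi e l) j x)%:A *: full pi (half_nl pi e l) j.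
Proof.
have [s [s_inj _ fE]] := halfE.
by have [b L] := half_basis s_inj fE; exact: full_basis b L x.
Qed.

End LatticeBases.

(** * Affine schemes as functors *)

Definition triple (R : comNzRingType) (m : nat) : Type :=
  (('cV[R]_m -> Prop) * ('cV[R]_m -> Prop) * ('cV[R]_m -> Prop))%type.

Definition extend_triple (R R' : comNzRingType) m (f : R -> R')
    (p : triple R m) : triple R' m :=
  (extend f p.1.1, extend f p.1.2, extend f p.2).

(* The functor [U] on [O]-algebras, given by a set [U R] of triples for each
   [R], is isomorphic to [Spec A], that is, naturally in bijection with the
   [O]-algebra morphisms from [A]. *)
Definition iso_Spec (O : comNzRingType) (m : nat)
    (U : forall R : comAlgType O, triple R m -> Prop) (A : comAlgType O) : Prop :=
  exists Phi : forall R : comAlgType O, {lrmorphism A -> R} -> triple R m,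
    [/\ forall R h, U R (Phi R h),
        forall R h h', Phi R h = Phi R h' -> h =1 h',
        forall R p, U R p -> exists h, Phi R h = p &
        forall (R R' : comAlgType O) (f : {lrmorphism R -> R'})
               (h : {lrmorphism A -> R}),
          Phi R' (f \o h) = extend_triple f (Phi R h)].

Definition chart (F0 : fieldType) (F : fieldExtType F0) (vF : valuation F)
    (pi : F) (bar : 'AEnd(F)) n (V : vectType F) (phi : V -> V -> F)
    (e : n.-tuple V) (l : nat) (i0 : 'I_n) (R : comAlgType (integers vF))
    (p : triple R (n + n)) : Prop :=
  chart_point pi bar phi e l i0 p.1.1 p.1.2 p.2.

(** * Quotients of polynomial algebras *)

Definition ideal_span (P : comNzRingType) (g : P -> Prop) : {pred P} :=
  fun x => `[< exists (s : nat) (a b : 'I_s -> P),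
    (forall i, g (b i)) /\ x = \sum_(i < s) a i * b i >].

(* The quotient rings of the library are nonzero, whence [relations_proper]. *)
Record relations (P : comNzRingType) := Relations {
  relations_set :> P -> Prop;
  relations_proper : 1 \notin ideal_span relations_set }.

Section QuotientAlgebra.

Variables (O : comNzRingType) (P : comAlgType O) (g : relations P).

Definition relations_ideal : {pred P} := ideal_span g.

Lemma relations_idealr : idealr_closed relations_ideal.
Proof.
split; last 1 first.
- move=> c u w /asboolP[s [a [b [gb ->]]]] /asboolP[s' [a' [b' [gb' ->]]]].
  apply/asboolP; exists (s + s')%N.
  exists (fun i => match split i with inl j => c * a j | inr j => a' j end).
  exists (fun i => match split i with inl j => b j | inr j => b' j end).
  split=> [i|]; first by case: (split i).
  rewrite big_split_ord mulr_sumr /=; congr (_ + _).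
    by apply: eq_bigr => i _; rewrite (unsplitK (inl i)) mulrA.
  by apply: eq_bigr => i _; rewrite (unsplitK (inr i)).
- apply/asboolP; exists 0%N, (fun=> 0), (fun=> 0); split=> [[]//|].
  by rewrite big_ord0.
- exact: relations_proper.
Qed.

HB.instance Definition _ := isIdealr.Build P relations_ideal relations_idealr.

Definition quotient_algebra : Type := {ideal_quot relations_ideal}.

HB.instance Definition _ := GRing.ComNzRing.on quotient_algebra.

Definition quotient_scale (a : O) (x : quotient_algebra) : quotient_algebra :=
  \pi_{ideal_quot relations_ideal} (a%:A) * x.

Fact quotient_scaleA a b x :
  quotient_scale a (quotient_scale b x) = quotient_scale (a * b) x.
Proof. by rewrite /quotient_scale mulrA -rmorphM /= mulr_algl scalerA. Qed.

Fact quotient_scale1 : left_id 1 quotient_scale.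
Proof. by move=> x; rewrite /quotient_scale scale1r rmorph1 mul1r. Qed.

Fact quotient_scaleDr : right_distributive quotient_scale +%R.
Proof. by move=> a x y; rewrite /quotient_scale mulrDr. Qed.

Fact quotient_scaleDl x : {morph quotient_scale^~ x : a b / a + b}.
Proof. by move=> a b; rewrite /quotient_scale scalerDl rmorphD mulrDl. Qed.

HB.instance Definition _ := GRing.Zmodule_isLmodule.Build O quotient_algebra
  quotient_scaleA quotient_scale1 quotient_scaleDr quotient_scaleDl.

Fact quotient_scaleAl (a : O) (x y : quotient_algebra) :
  a *: (x * y) = a *: x * y.
Proof. exact: mulrA. Qed.

HB.instance Definition _ :=
  GRing.Lmodule_isLalgebra.Build O quotient_algebra quotient_scaleAl.

Fact quotient_scaleAr (a : O) (x y : quotient_algebra) :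
  a *: (x * y) = x * (a *: y).
Proof. exact: mulrCA. Qed.

HB.instance Definition _ :=
  GRing.Lalgebra_isAlgebra.Build O quotient_algebra quotient_scaleAr.

End QuotientAlgebra.

(** * The coordinate rings of the charts *)

Definition antidiag (R : comNzRingType) (d : nat) : 'M[R]_d :=
  \matrix_(i, j) (j == rev_ord i)%:R.

Fact mid_ord_subproof n l (j : 'I_(n - 2 * l)) : (2 * l + j < n)%N.
Proof. by rewrite -ltn_subRL. Qed.

Definition mid_ord n l (j : 'I_(n - 2 * l)) : 'I_n := Ordinal (mid_ord_subproof j).

(* At a point where all the elements of [g] have positive valuation, so have
   those of the ideal they generate. *)
Lemma proper_at (K : fieldType) (v : valuation K) N
    (g : {mpoly (integers v)[N]} -> Prop) (x : 'I_N -> integers v) :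
  (forall p, g p -> (\val p.@[x] == 0) || (0 < v (\val p.@[x]))) ->
  1 \notin ideal_span g.
Proof.
move=> gx; apply/negP => /asboolP[s [a [b [gb /(congr1 (meval x))]]]].
rewrite meval1 raddf_sum /= => /(congr1 val); rewrite raddf_sum /= => E.
suff: (\sum_(i < s) \val (a i * b i).@[x] == 0) ||
      (0 < v (\sum_(i < s) \val (a i * b i).@[x])).
  by rewrite -E /= oner_eq0 valuation1.
apply: (big_ind (fun y => (y == 0) || (0 < v y))) => [|y z|i _].
- by rewrite eqxx.
- have [->|y0] := eqVneq y 0; first by rewrite add0r.
  have [->|z0] := eqVneq z 0; first by rewrite addr0 (negPf y0).
  move=> /= vy vz; have [//|yz0] /= := eqVneq (y + z) 0.
  by apply: lt_le_trans (valuationD v y0 z0 yz0); rewrite lt_min vy vz.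
- rewrite mevalM /=; case/orP: (gx _ (gb i)) => [/eqP ->|vb].
    by rewrite mulr0 eqxx.
  have := valP (a i).@[x]; rewrite inE => /orP[/eqP ->|va].
    by rewrite mul0r eqxx.
  have [->|b0] := eqVneq (\val (b i).@[x]) 0; first by rewrite mulr0 eqxx.
  have [->|a0] := eqVneq (\val (a i).@[x]) 0; first by rewrite mul0r eqxx.
  by rewrite (valuationM v) // ltr_wpDl ?orbT.
Qed.

Section CoordinateRings.

Variables (F : fieldType) (vF : valuation F) (pi : F) (hpi : uniformizer vF pi).
Variables (n l : nat) (i0 : 'I_n).

Local Notation OF := (integers vF).
Local Notation piO := (to_integers vF pi).
Local Notation d := (n - 2 * l)%N.

Fact val_2pi :
  (\val (- (2%:R * piO)) == 0) || (0 < vF (\val (- (2%:R * piO)))).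
Proof.
have [pi0 v1] := hpi.
have e : \val piO = pi by rewrite insubdK // !inE v1 orbT.
rewrite -mulNr; move: (- 2%:R : OF) => c; rewrite rmorphM /= -/(\val piO) e.
have := valP c; rewrite inE /=.
have [->|z0] := eqVneq (integers_val c) 0; first by rewrite mul0r eqxx.
by move=> /= vc; rewrite (valuationM vF) // v1 ltr_wpDl ?orbT.
Qed.

(* The indeterminates are [v_1, ..., v_n] and [z_(2l+1), ..., z_n]. *)
Section First.

Local Notation P := {mpoly OF[n + d]}.

Let V : 'cV[P]_n := \col_i 'X_(lshift d i).
Let V2 : 'cV[P]_d := \col_j V (mid_ord j) 0.
Let Z2 : 'cV[P]_d := \col_j 'X_(rshift n j).

Definition relations1_set : P -> Prop := fun p =>
  [\/ p = V i0 0 - 1,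
      minors 2 (row_mx V2 (antidiag _ d *m Z2)) p |
      p = (Z2^T *m V2) 0 0 - (2%:R * piO)%:MP].

Fact relations1_proper : 1 \notin ideal_span relations1_set.
Proof.
pose x (i : 'I_(n + d)) : OF := (i == lshift d i0)%:R.
have xZ j : (Z2 j 0).@[x] = 0 by rewrite mxE mevalXU /x eq_rlshift.
apply: (@proper_at _ _ _ _ x) => p [->|[f [g ->]]|->].
- by rewrite mevalB meval1 mxE mevalXU /x eqxx subrr eqxx.
- rewrite -det_map_mx /= -det_tr.
  suff -> : \det (map_mx (meval x) (mxsub f g (row_mx V2 (antidiag _ d *m Z2))))^T = 0.
    by rewrite eqxx.
  have M j b : (row_mx V2 (antidiag _ d *m Z2) j (rshift 1 b)).@[x] = 0.
    rewrite row_mxEr ord1 mxE raddf_sum big1 //= => i _.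
    by rewrite mevalM xZ mulr0.
  have gP b : g b = rshift 1 0 \/ g b = lshift 1 0.
    by case: (split_ordP (g b)) => i ->; rewrite ord1; [right|left].
  have [/existsP[b /eqP gb]|] := boolP [exists b, g b == rshift 1 0].
    by rewrite (expand_det_row _ b) big1 // => j _; rewrite mxE [map_mx _ _ _ _]mxE
      [mxsub _ _ _ _ _]mxE gb M mul0r.
  rewrite negb_exists => /forallP g0.
  have g01 : g 0 = g 1.
    by have := g0 0; have := g0 1; case: (gP 0) (gP 1) => [] -> [] -> //; rewrite eqxx.
  apply: (@determinant_alternate _ _ _ 0 1) => // j.
  by rewrite mxE [RHS]mxE ![map_mx _ _ _ _]mxE ![mxsub _ _ _ _ _]mxE g01.
- rewrite mevalB mxE raddf_sum big1 /= => [|i _].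
    by rewrite mevalC sub0r; exact: val_2pi.
  by rewrite mxE mevalM xZ mul0r.
Qed.

Definition relations1 : relations P := Relations relations1_proper.

End First.

(* The indeterminates are [v_1, ..., v_n] and [u]. *)
Section Second.

Local Notation P := {mpoly OF[n + 1]}.

Let V : 'cV[P]_n := \col_i 'X_(lshift 1 i).
Let V2 : 'cV[P]_d := \col_j V (mid_ord j) 0.
Let u : P := 'X_(rshift n 0).

Definition relations2_set : P -> Prop := fun p =>
  p = V i0 0 - 1 \/
  p = u * (V2^T *m antidiag _ d *m V2) 0 0 - (2%:R * piO)%:MP.

Fact relations2_proper : 1 \notin ideal_span relations2_set.
Proof.
pose x (i : 'I_(n + 1)) : OF := (i == lshift 1 i0)%:R.
apply: (@proper_at _ _ _ _ x) => p [->|->].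
- by rewrite mevalB meval1 mxE mevalXU /x eqxx subrr eqxx.
- rewrite mevalB mevalM mevalXU /x eq_rlshift mul0r mevalC sub0r.
  exact: val_2pi.
Qed.

Definition relations2 : relations P := Relations relations2_proper.

End Second.

Definition chart_algebra1 : comAlgType OF := quotient_algebra relations1.
Definition chart_algebra2 : comAlgType OF := quotient_algebra relations2.

End CoordinateRings.

(* Main.v *)
(* Put p for the image of pi in R and M for the signed antidiagonal matrix
   [pairing], so that the Gram matrix is [0, M; -M, 0]. On the chart, (t + pi)
   maps F_(n-l) into the line spanned by (Y v; v), hence Y + p = v w^T for a
   unique w, and the characteristic polynomial forces w^T v = 2p; orthogonality
   gives X = M^T Y^T M, so X + p = (M^T w) (M^T v)^T also has rank one.
   Everything but the two inclusion conditions is then automatic. Since v has a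
   unit entry, the latter amount to: the first 2l entries of w are r times those
   of M^T v, where 2r = z^T H z and z is formed by the last n - 2l entries of w,
   the matrix [V_2 | H z] has rank at most one, and z^T V_2 = 2p. So for every
   i_0 the chart represents the pairs (v, z) with the last two properties and
   v_(i_0) = 1. When i_0 > 2l the column V_2 has a unit entry, and the rank
   condition becomes z = u H V_2 for a unique scalar u. *)

(* Over an arbitrary algebra R neither ranks nor cancellation are available. Their place is taken by
   the entry v_(i0) = 1, by monic polynomials, and by 2, which is a unit because the residue
   characteristic is not 2. The shape of the answer comes from the two blocks of M. On the first 2l
   indices M is skew; on the others it is -H, hence symmetric. So a low part of w proportional to
   that of M^T v is orthogonal to the low part of v, and w^T v = 2p becomes z^T V_2 = 2p. The first
   inclusion is quadratic in w: its low block equates (M^T w) v^T + v (M^T w)^T with -(z^T H z) v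
   v^T. The diagonal entry at a low i0 is twice an entry of M^T w, whence the half in r. For a high
   i0 that entry is out of reach, and r is found instead as p u from z = u H V_2. *)
Require Import Defs.
From HB Require Import structures.
From mathcomp Require Import all_boot all_order all_algebra all_field.
From mathcomp Require Import boolp mpoly zify ring.

Set Implicit Arguments.
Unset Strict Implicit.
Unset Printing Implicit Defensive.

Import Order.TTheory GRing.Theory Num.Theory.
Local Open Scope ring_scope.
Local Open Scope quotient_scope.

(** * Column spans, graphs and matrices of rank one *)

Section Colspan.

Variables (R : comNzRingType) (m r : nat).

Lemma colspan_submodule (B : 'M[R]_(m, r)) : submodule (colspan B).
Proof.
split=> [|a _ _ [c ->] [c' ->]]; first by exists 0; rewrite mulmx0.
by exists (a *: c + c'); rewrite mulmxDr scalemxAr.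
Qed.

Lemma extend_colspan (R' : comNzRingType) (f : {rmorphism R -> R'})
    (B : 'M[R]_(m, r)) :
  extend f (colspan B) = colspan (map_mx f B).
Proof.
apply/funext => x; apply/propext; split=> [[s [a [y [yB ->]]]]|[c ->]].
  apply: (big_ind (colspan (map_mx f B))) => [|_ _ [c ->] [c' ->]|i _].
  - by exists 0; rewrite mulmx0.
  - by exists (c + c'); rewrite mulmxDr.
  - by have [c ->] := yB i; exists (a i *: map_mx f c);
      rewrite map_mxM scalemxAr.
exists r, (fun i => c i 0), (fun i => col i B); split=> [i|].
  by exists (delta_mx i 0); rewrite colE.
apply/matrixP => i j; rewrite ord1 mxE summxE.
by apply: eq_bigr => k _; rewrite !mxE mulrC.
Qed.

Lemma extend_whole (R' : comNzRingType) (f : {rmorphism R -> R'}) :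
  extend f (@whole R m) = @whole R' m.
Proof.
have wholeE (S : comNzRingType) : @whole S m = colspan 1%:M.
  by apply/funext => x; apply/propext; split=> // _; exists x; rewrite mul1mx.
rewrite wholeE; apply/funext => x; apply/propext; split=> // _.
exists m, (fun i => x i 0), (fun i => col i 1%:M); split=> [i|].
  by exists (col i 1%:M); rewrite mul1mx.
apply/matrixP => i j; rewrite ord1 summxE (bigD1 i) //= big1 => [|k ki].
  by rewrite !mxE eqxx rmorph1 mulr1 addr0.
by rewrite !mxE eq_sym (negPf ki) rmorph0 mulr0.
Qed.

End Colspan.

Lemma det_mx22 (R : comNzRingType) (A : 'M[R]_2) :
  \det A = A 0 0 * A 1 1 - A 0 1 * A 1 0.
Proof.
rewrite (expand_det_row _ 0) !big_ord_recl big_ord0 /cofactor !det_mx11 !mxE /=.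
rewrite (_ : lift 0 0 = 1); last exact: val_inj.
rewrite (_ : lift 1 0 = 0); last exact: val_inj.
by rewrite /bump /= !expr1 expr0; ring.
Qed.

Section Similarity.

Variables (R : comNzRingType) (n : nat).

(** The determinants of P and Q are mutually inverse scalars, so taking determinants of P (X - T) =
    (X - A) P and multiplying by det Q removes P. *)
Lemma char_poly_similar (A T P Q : 'M[R]_n) :
  P *m Q = 1%:M -> P *m T = A *m P -> char_poly T = char_poly A.
Proof.
move=> PQ PT; pose P' := map_mx polyC P; pose Q' := map_mx polyC Q.
have E : P' *m char_poly_mx T = char_poly_mx A *m P'.
  rewrite /char_poly_mx mulmxBr mulmxBl -!map_mxM PT.
  by rewrite mul_scalar_mx mul_mx_scalar.
have PQ1 : \det P' * \det Q' = 1.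
  by rewrite -det_mulmx -map_mxM PQ map_mx1 det1.
have := congr1 (fun B => \det B * \det Q') E; rewrite !det_mulmx -/P'.
by rewrite mulrAC PQ1 mul1r -mulrA PQ1 mulr1.
Qed.

(** Multiplying A v = 0 by the adjugate gives (det A) v = 0, which is read at the unit entry of
    v. *)
Lemma det_eq0_kernel (A : 'M[R]_n) (v : 'cV[R]_n) i b :
  v i 0 * b = 1 -> A *m v = 0 -> \det A = 0.
Proof.
move=> vi Av; have := congr1 (fun w => (\adj A *m w) i 0 * b) Av.
by rewrite mulmxA mul_adj_mx mul_scalar_mx mulmx0 !mxE mul0r -mulrA vi mulr1.
Qed.

(* Two factorizations of the determinant of the block matrix
   [1, y^T; x, c]. *)
Lemma det_scalar_sub_rank1 (c : R) (x y : 'cV[R]_n) :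
  \det (c%:M - x *m y^T) * c = c ^+ n * (c - (y^T *m x) 0 0).
Proof.
pose B := block_mx (1%:M : 'M_1) y^T x c%:M.
have L : B = block_mx 1%:M 0 x 1%:M *m block_mx 1%:M y^T 0 (c%:M - x *m y^T).
  rewrite mulmx_block !mul1mx !mulmx1 !mulmx0 !mul0mx !addr0.
  by rewrite addrC subrK.
have U : B *m block_mx c%:M 0 (- x) 1%:M
       = block_mx (c%:M - y^T *m x) y^T 0 c%:M.
  rewrite mulmx_block !mul1mx !mulmx1 !mulmx0 !mulmxN !add0r.
  by rewrite mul_mx_scalar mul_scalar_mx subrr.
have dB : \det B = \det (c%:M - x *m y^T).
  rewrite L det_mulmx det_lblock det_ublock.
  by rewrite !det_scalar !expr1n !mul1r.
have := congr1 determinant U; rewrite det_mulmx dB det_lblock det_ublock.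
rewrite !det_scalar expr1n mulr1 expr1 => ->.
by rewrite det_mx11 !mxE eqxx mulr1n mulrC.
Qed.

End Similarity.

Section RankOne.

Variables (R : comNzRingType) (n : nat).

(** This is [det_scalar_sub_rank1] over the polynomial ring with c = X + p: there c is monic, so the
    extra factor c on both sides cancels. *)
Lemma char_poly_rank1 (p : R) (x y : 'cV[R]_n) : (0 < n)%N ->
  char_poly (x *m y^T - p%:M) =
    ('X + p%:P) ^+ n.-1 * ('X + p%:P - ((y^T *m x) 0 0)%:P).
Proof.
move=> n0; pose c : {poly R} := 'X + p%:P.
have cE : c = 'X - (- p)%:P by rewrite polyCN opprK.
have := det_scalar_sub_rank1 c (map_mx polyC x) (map_mx polyC y).
rewrite map_trmx -!map_mxM.
have -> : map_mx polyC (y^T *m x) 0 0 = ((y^T *m x) 0 0)%:P by rewrite mxE.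
have -> : c ^+ n = c ^+ n.-1 * c by rewrite -exprSr prednK.
rewrite -mulrA [c * _]mulrC mulrA.
have /monic_rreg creg : c \is monic by rewrite cE monicXsubC.
move/creg => <-; rewrite /char_poly /char_poly_mx map_mxB map_scalar_mx opprB.
by rewrite raddfD /= addrA.
Qed.

Lemma minors2_rank1 m q (x : 'cV[R]_m) (y : 'rV[R]_q) a :
  minors 2 (x *m y) a -> a = 0.
Proof.
by move=> [f [g ->]]; rewrite det_mx22 !mxE !big_ord1; ring.
Qed.

End RankOne.

Section Graph.

Variables (R : comNzRingType) (n : nat).
Implicit Types (A B : 'M[R]_n) (h : 'M[R]_(n + n)).

(** The identity block lets coefficients be read off: c is the lower half of [graph A *m c]. *)
Definition graph A : 'M[R]_(n + n, n) := col_mx A 1%:M.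

Lemma graph_mul A k (c : 'M[R]_(n, k)) : graph A *m c = col_mx (A *m c) c.
Proof. by rewrite mul_col_mx mul1mx. Qed.

Lemma graphP A x : colspan (graph A) x <-> x = graph A *m dsubmx x.
Proof.
split=> [[c ->]|->]; last by exists (dsubmx x).
by rewrite [in dsubmx _]graph_mul col_mxKd.
Qed.

Lemma graph_free A k (c : 'M[R]_(n, k)) : graph A *m c = 0 -> c = 0.
Proof. by rewrite graph_mul -col_mx0 => /eq_col_mx[]. Qed.

Lemma graph_mulI A k (c c' : 'M[R]_(n, k)) :
  graph A *m c = graph A *m c' -> c = c'.
Proof. by rewrite !graph_mul => /eq_col_mx[]. Qed.

(** Two graphs have the same lower block, so containment already forces the upper blocks to
    agree. *)
Lemma graph_sub A B :
  (forall x, colspan (graph A) x -> colspan (graph B) x) -> A = B.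
Proof.
move=> AB; apply/matrixP => i j.
have /AB/graphP : colspan (graph A) (graph A *m delta_mx j 0) by exists
  (delta_mx j 0).
rewrite !graph_mul col_mxKd => /eq_col_mx[] /(congr1 (fun c : 'cV_n =>
  c i 0)) + _.
by rewrite -!colE !mxE.
Qed.

Lemma map_graph (R' : comNzRingType) (f : {rmorphism R -> R'}) A :
  map_mx f (graph A) = col_mx (map_mx f A) 1%:M.
Proof. by rewrite map_col_mx map_mx1. Qed.

End Graph.

Section GraphModule.

Variables (R : comNzRingType) (n : nat).
Implicit Types (A B : 'M[R]_n) (h : 'M[R]_(n + n)).

Lemma graph_cols A k (X : 'M[R]_(n + n, k)) :
  (forall j, colspan (graph A) (col j X)) -> X = graph A *m dsubmx X.
Proof.
move=> XA; apply/matrixP => i j.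
have /graphP/(congr1 (fun c : 'cV_(n+n) => c i 0)) := XA j; rewrite mxE => ->.
rewrite !mxE; apply: eq_bigr => b _; congr (_ * _).
by rewrite !mxE.
Qed.

Lemma local_summand_free m r (M N : 'cV[R]_m -> Prop) :
  (forall (R' : comNzRingType) (f : {rmorphism R -> R'}),
     direct_summand (extend f M) (extend f N) /\
     exists B : 'M[R']_(m, r), col_basis B (extend f N)) ->
  local_summand r M N.
Proof.
move=> MN; exists 1%N, (fun=> 1); split; last by move=> i R' f _; exact: MN.
by exists (fun=> 1); rewrite big_ord1 mulr1.
Qed.

Lemma graph_local_summand A :
  local_summand n (@whole R (n + n)) (colspan (graph A)).
Proof.
apply: local_summand_free => R' f.
rewrite extend_whole extend_colspan map_graph -/(graph _).
set A' := map_mx f A; split; last first.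
  by exists (graph A'); split=> // c; apply: graph_free.
(* The complement consists of the vectors with zero lower half. *)
split=> //; exists (fun x => dsubmx x = 0); split=> //.
- by split=> [|a x y x0 y0]; rewrite ?linear0 // linearP /= x0 y0 scaler0 addr0.
- move=> x _; exists (graph A' *m dsubmx x), (x - graph A' *m dsubmx x); split.
  + by exists (dsubmx x).
  + by rewrite linearB /= graph_mul col_mxKd subrr.
  + by rewrite addrC subrK.
- by move=> x /graphP -> ; rewrite [in dsubmx _]graph_mul col_mxKd => ->;
    rewrite mulmx0.
Qed.

Lemma vector_local_summand A (v : 'cV[R]_n) i : v i 0 = 1 ->
  local_summand 1 (colspan (graph A)) (colspan (graph A *m v)).
Proof.
move=> vi; apply: local_summand_free => R' f.
rewrite !extend_colspan map_mxM !map_graph -/(graph _).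
set A' := map_mx f A; set v' := map_mx f v.
have v'i : v' i 0 = 1 by rewrite mxE vi rmorph1.
have vc (c : 'cV_1) : (v' *m c) i 0 = c 0 0 by rewrite mxE big_ord1 v'i mul1r.
split; last first.
  exists (graph A' *m v'); split=> // c; rewrite -mulmxA => /graph_free vc0.
  by apply/matrixP => a b; rewrite !ord1 -vc vc0 !mxE.
split=> [_ [c ->]|]; first by exists (v' *m c); rewrite mulmxA.
(* As v has entry 1 at i, the i-th lower coordinate projects the graph onto the line; the complement
   is the kernel of this projection. *)
exists (fun x => colspan (graph A') x /\ dsubmx x i 0 = 0); split.
- split; first by split; [exists 0; rewrite mulmx0|rewrite linear0 mxE].
  move=> a x y [xA x0] [yA y0]; split; first exact: (colspan_submodule _).2.
  by rewrite linearP [LHS]mxE [X in X + _]mxE x0 y0 mulr0 addr0.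
- by move=> x [].
- move=> _ [c ->]; exists (graph A' *m v' *m (c i 0)%:M).
  exists (graph A' *m (c - v' *m (c i 0)%:M)); split.
  + by exists (c i 0)%:M.
  + split; first by exists (c - v' *m (c i 0)%:M).
    by rewrite graph_mul col_mxKd mxE [X in _ + X]mxE vc mxE eqxx mulr1n subrr.
  + by rewrite mulmxBr mulmxA addrC subrK.
- move=> _ [c ->] [_]; rewrite -mulmxA graph_mul col_mxKd vc => c0.
  by rewrite (_ : c = 0) ?mulmx0 ?linear0 ?col_mx0 //;
     apply/matrixP => a b; rewrite !ord1 mxE.
Qed.

End GraphModule.

Section GraphConditions.

Variables (R : comNzRingType) (n : nat).
Implicit Types (A B : 'M[R]_n) (h : 'M[R]_(n + n)).

(** The condition ranges over all bases B of all localizations. Each B differs from the graph by an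
    invertible matrix, so T is similar to the image of A. *)
Lemma graph_char_poly_on h A Q : h *m graph A = graph A *m A ->
  char_poly A = Q -> char_poly_on n h (colspan (graph A)) Q.
Proof.
move=> hA <- s R' f _ B T.
rewrite extend_colspan map_graph -/(graph _) map_char_poly.
have {hA} : map_mx f h *m graph (map_mx f A) = graph (map_mx f A) *m map_mx f A.
  by move/(congr1 (map_mx f)): hA; rewrite !map_mxM map_graph.
move: (map_mx f A) (map_mx f h) => {}A {}h hA [AB Bfree] hB.
pose P := dsubmx B.
have BE : B = graph A *m P.
  apply: graph_cols => j; apply/AB; exists (delta_mx j 0); exact: colE.
have [P' AE] : exists P', graph A = B *m P'.
  have /fin_all_exists[Q' AQ] j : exists c : 'cV_n, col j (graph A) = B *m c.
    by apply/AB; exists (delta_mx j 0); rewrite colE.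
  exists (\matrix_(i, j) Q' j i 0); apply/matrixP => i j.
  have /(congr1 (fun c : 'cV_(n+n) => c i 0)) := AQ j; rewrite !mxE => ->.
  by apply: eq_bigr => b _; rewrite mxE.
have PQ : P *m P' = 1%:M.
  by apply: (@graph_mulI _ _ A); rewrite mulmxA -BE -AE mulmx1.
apply: (char_poly_similar PQ); apply: (@graph_mulI _ _ A).
by rewrite !mulmxA -BE -hB BE mulmxA hA.
Qed.

(** Vectors of the graph form a product [graph A *m C], and [h] maps it to [graph A *m B *m C]. Its
    minors of size n are products of three square determinants, the middle one being det B. *)
Lemma wedge_zero_det h A B : h *m graph A = graph A *m B ->
  \det B = 0 -> wedge_zero n h (colspan (graph A)).
Proof.
move=> hA B0 X /graph_cols -> x [f [g ->]]; rewrite mulmxA hA.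
rewrite mxsub_mul -mul_rowsub_mx.
by rewrite !det_mulmx B0 mulr0 mul0r.
Qed.

Lemma wedge_zero_rank1 h A (x y : 'cV[R]_n) :
  h *m graph A = graph A *m (x *m y^T) ->
  wedge_zero 2 h (colspan (graph A)).
Proof.
move=> hA X /graph_cols -> a; rewrite mulmxA hA !mulmxA -mulmxA.
exact: minors2_rank1.
Qed.

End GraphConditions.

(** * The inclusion conditions *)

Section Flip.

Variables (n l : nat).
Hypothesis l2n : (2 * l <= n)%N.

(* Reverses the first [2l] indices and, separately, the last [n - 2l] ones. *)
Definition flip (i : 'I_n) : 'I_n :=
  insubd i (if (i < 2 * l)%N then (2 * l).-1 - i else n.-1 - (i - 2 * l))%N.

Lemma val_flip i :
  flip i = (if (i < 2 * l)%N then (2 * l).-1 - i else n.-1 - (i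
    - 2 * l))%N :> nat.
Proof.
rewrite val_insubd ifT //; have := ltn_ord i; case: ifP; lia.
Qed.

Lemma flip_low i : (flip i < 2 * l)%N = (i < 2 * l)%N.
Proof. by have := ltn_ord i; rewrite val_flip; case: ifP; lia. Qed.

Lemma flipK : involutive flip.
Proof.
move=> i; apply: val_inj; rewrite /= val_flip flip_low val_flip.
by have := ltn_ord i; case: ifP => il; rewrite ?il; lia.
Qed.

Lemma flip_mid (j : 'I_(n - 2 * l)) : flip (mid_ord j) = mid_ord (rev_ord j).
Proof.
by apply: val_inj; have := ltn_ord j; rewrite /= val_flip /=; case: ifP; lia.
Qed.

Lemma mid_low j : (@mid_ord n l j < 2 * l)%N = false.
Proof. by rewrite ltnNge leq_addr. Qed.

Lemma low_or_mid (i : 'I_n) : (i < 2 * l)%N \/ exists j : 'I_(n - 2 * l), i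
  = mid_ord j.
Proof.
have [|il] := ltnP i (2 * l); [by left|right].
have ji : (i - 2 * l < n - 2 * l)%N by have := ltn_ord i; lia.
by exists (Ordinal ji); apply: val_inj; rewrite /= subnKC.
Qed.

Lemma sum_low_mid (R : nmodType) (F : 'I_n -> R) :
  \sum_(i < n) F i = \sum_(i < n | (i < 2 * l)%N) F i
    + \sum_j F (@mid_ord n l j).
Proof.
rewrite (bigID (fun i : 'I_n => (i < 2 * l)%N)) /=; congr (_ + _).
rewrite (reindex_omap (@mid_ord n l) (fun i : 'I_n => insub (i - 2 * l)%N)).
  by apply: eq_bigl => j; rewrite mid_low /= addKn valK eqxx.
move=> i; rewrite -leqNgt => il.
have ji : (i - 2 * l < n - 2 * l)%N by have := ltn_ord i; lia.
by rewrite insubT /=; congr Some; apply: val_inj; rewrite /= subnKC.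
Qed.

Variable R : comNzRingType.

(** The sign is -1 where [half_nl] carries a factor pi^-1: phi is conjugate-linear in its first
    argument, and conjugation negates pi^-1. *)
Definition sgn (i : 'I_n) : R := if (i < l)%N then 1 else -1.

Lemma sgn_sqr (i : 'I_n) : sgn i * sgn i = 1.
Proof. by rewrite /sgn; case: ifP; rewrite ?mulrNN mulr1. Qed.

(** This makes the low block of [pairing] skew, whereas by [sgn_mid] the high block is symmetric. *)
Lemma sgn_flip_low (i : 'I_n) : (i < 2 * l)%N -> sgn (flip i) = - sgn i.
Proof.
move=> il; rewrite /sgn val_flip il.
by case: ifP => a; case: ifP => b; rewrite ?opprK //; exfalso; lia.
Qed.

Lemma sgn_mid (j : 'I_(n - 2 * l)) : sgn (mid_ord j) = -1.
Proof. by rewrite /sgn ifF //=; lia. Qed.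

Definition pairing : 'M[R]_n := \matrix_(i, j) (sgn i *+ (j == flip i)).

Lemma pairingE k (A : 'M[R]_(n, k)) i j :
  (pairing *m A) i j = sgn i * A (flip i) j.
Proof.
rewrite mxE (bigD1 (flip i)) //= big1 => [|a ai]; last first.
  by rewrite mxE (negPf ai) mul0r.
by rewrite mxE eqxx mulr1n addr0.
Qed.

Lemma pairing_trE k (A : 'M[R]_(n, k)) i j :
  (pairing^T *m A) i j = sgn (flip i) * A (flip i) j.
Proof.
rewrite mxE (bigD1 (flip i)) //= big1 => [|a ai]; last first.
  rewrite !mxE (_ : (i == flip a) = false) ?mul0r //.
  by apply: contra_neqF ai => /eqP ->; rewrite flipK.
by rewrite !mxE flipK eqxx mulr1n addr0.
Qed.

Lemma pairing_mulV : pairing *m pairing^T = 1%:M.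
Proof.
apply/matrixP => i j; rewrite pairingE !mxE (inj_eq (can_inj flipK)) eq_sym.
by case: eqVneq => [->|_]; rewrite ?mulr0 // mulr1n sgn_sqr.
Qed.

Lemma pairing_Vmul : pairing^T *m pairing = 1%:M.
Proof. exact: mulmx1C pairing_mulV. Qed.

(** [lowmx] projects onto the basis vectors common to both lattices, [highmx] onto those that differ
    by a factor pi; see [half_l_nl]. *)
Definition lowmx : 'M[R]_n := diag_mx (\row_i ((i < 2 * l)%N)%:R).
Definition highmx : 'M[R]_n := diag_mx (\row_i (~~ (i < 2 * l)%N)%:R).

End Flip.

Section Rank1Inclusion.

Variables (R : comNzRingType) (n : nat).

(** The terms p D and p^2 D' cancel, so only terms containing a rank one factor survive. *)
Lemma rank1_inclusion (D D' : 'M[R]_n) (x y z w : 'cV[R]_n) (p : R) :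
  D *m (x *m y^T - p%:M) + p ^+ 2 *: D'
    - (z *m w^T - p%:M) *m (D' *m (x *m y^T - p%:M) + D)
  = D *m x *m y^T - (w^T *m D' *m x) 0 0 *: (z *m y^T)
    + p *: (z *m w^T *m D') - z *m w^T *m D + p *: (D' *m x *m y^T).
Proof.
have E : z *m w^T *m (D' *m (x *m y^T)) = (w^T *m D' *m x) 0 0 *: (z *m y^T).
  transitivity (z *m (w^T *m D' *m x) *m y^T); first by rewrite !mulmxA.
  by rewrite {1}[w^T *m _ *m _]mx11_scalar mul_mx_scalar scalemxAl.
rewrite !mulmxBr !mulmxBl !mulmxDr E !mul_mx_scalar !mul_scalar_mx.
rewrite mulmxN -scalemxAr !scalerN scalerA -expr2 !mulmxA.
move: (D *m x *m y^T) (z *m y^T) (z *m w^T *m D') (z *m w^T *m D)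
  (D' *m x *m y^T) ((w^T *m D' *m x) 0 0) => A1 A2 A3 A4 A5 c.
apply/matrixP => i j; rewrite !mxE; ring.
Qed.

End Rank1Inclusion.

Section InclusionConditions.

Variables (R : comNzRingType) (n l : nat).
Hypothesis l2n : (2 * l <= n)%N.
Variables (p half : R).
Hypothesis halfE : 2%:R * half = 1.
Implicit Types (v w : 'cV[R]_n) (z : 'cV[R]_(n - 2 * l)).

Lemma two_mulI (x y : R) : 2%:R * x = 2%:R * y -> x = y.
Proof.
by move/(congr1 ( *%R half)); rewrite !mulrA [half * _]mulrC halfE !mul1r.
Qed.

Definition dual v : 'cV[R]_n := (pairing n l R)^T *m v.

Lemma dualE v i : dual v i 0 = sgn l R (flip l i) * v (flip l i) 0.
Proof. exact: pairing_trE. Qed.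

Lemma dual_low v (i : 'I_n) : (i < 2 * l)%N ->
  dual v i 0 = - (sgn l R i * v (flip l i) 0).
Proof. by move=> il; rewrite dualE sgn_flip_low // mulNr. Qed.

Lemma dual_mid v (j : 'I_(n - 2 * l)) :
  dual v (mid_ord j) 0 = - v (mid_ord (rev_ord j)) 0.
Proof.
rewrite dualE flip_mid // sgn_mid; last exact: l2n.
by rewrite mulN1r.
Qed.

(* The pairing is alternating on the first [2l] coordinates. *)
Lemma dual_orthogonal v :
  \sum_(i < n | (i < 2 * l)%N) dual v i 0 * v i 0 = 0.
Proof.
set S := \sum_(i < n | _) _; suff E : S = - S.
  by apply: two_mulI; rewrite mulr0 mulr_natl mulr2n {1}E addNr.
rewrite {1}/S (reindex_inj (can_inj (flipK l2n))) /= -sumrN.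
apply: eq_big => [i|i]; rewrite flip_low // => il.
by rewrite !dualE flipK // sgn_flip_low //; ring.
Qed.

Lemma dual_dot v w : ((dual v)^T *m dual w) = v^T *m w.
Proof.
by rewrite trmx_mul trmxK mulmxA -(mulmxA v^T) pairing_mulV // mulmx1.
Qed.

Definition mid v : 'cV[R]_(n - 2 * l) := \col_j v (mid_ord j) 0.

Definition half_square z : R :=
  half * (z^T *m antidiag R (n - 2 * l) *m z) 0 0.

(* The vector w such that Y + p = v w^T, recovered from v and z. *)
Definition cofactor_of v z : 'cV[R]_n :=
  \col_i if (i < 2 * l)%N then half_square z * dual v i 0
         else oapp (fun j => z j 0) 0 (insub (i - 2 * l)%N).

Lemma cofactor_low v z (i : 'I_n) : (i < 2 * l)%N ->
  cofactor_of v z i 0 = half_square z * dual v i 0.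
Proof. by move=> il; rewrite mxE il. Qed.

Lemma cofactor_mid v z j : cofactor_of v z (mid_ord j) 0 = z j 0.
Proof. by rewrite mxE mid_low /= addKn valK. Qed.

Lemma mid_cofactor v z : mid (cofactor_of v z) = z.
Proof. by apply/matrixP => j k; rewrite mxE cofactor_mid ord1. Qed.

Lemma antidiagE d (x : 'cV[R]_d) j : (antidiag R d *m x) j 0 = x (rev_ord j) 0.
Proof.
rewrite mxE (bigD1 (rev_ord j)) //= big1 => [|k kj]; last first.
  by rewrite mxE (negPf kj) mul0r.
by rewrite mxE eqxx mul1r addr0.
Qed.

Lemma half_squareE z :
  2%:R * half_square z = \sum_j z j 0 * z (rev_ord j) 0.
Proof.
rewrite mulrA halfE mul1r -mulmxA mxE.
by apply: eq_bigr => j _; rewrite antidiagE mxE.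
Qed.

(** The first clause is the vanishing of the minors of [V_2 | H z], written entrywise; see
    [admissible_minors]. *)
Definition admissible v z : Prop :=
  (forall i j, mid v i 0 * z (rev_ord j) 0 = mid v j 0 * z (rev_ord i) 0) /\
  \sum_j z j 0 * mid v j 0 = 2%:R * p.

Definition modX v w : 'M[R]_n := dual w *m (dual v)^T - p%:M.
Definition modY v w : 'M[R]_n := v *m w^T - p%:M.

Local Notation lowm := (lowmx n l R).
Local Notation highm := (highmx n l R).

(* Conditions (2) of the moduli problem, see [incl_graph]. *)
Definition inclusions v w : Prop :=
  lowm *m modX v w + p ^+ 2 *: highm = modY v w *m (highm *m modX v w + lowm) /\
  highm *m modY v w + p ^+ 2 *: lowm = modX v w *m (lowm *m modY v w + highm).

Local Notation low i := ((i < 2 * l)%N%:R : R).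
Local Notation high i := ((~~ (i < 2 * l)%N)%:R : R).

(** The scalar of [rank1_inclusion] is w^T high (M^T w) for the first inclusion, which sees only
    high entries. For the second it is (M^T v)^T low v, which vanishes by [dual_orthogonal]. *)
Lemma inclusionsP v w : inclusions v w <->
  (forall i j : 'I_n, low i * dual w i 0 * dual v j 0
     - (\sum_(a < n - 2 * l) w (mid_ord a) 0 * dual w (mid_ord a) 0)
         * (v i 0 * dual v j 0)
     + p * (v i 0 * w j 0 * high j) - v i 0 * w j 0 * low j
     + p * (high i * dual w i 0 * dual v j 0) = 0) /\
  (forall i j : 'I_n, high i * v i 0 * w j 0
     + p * (dual w i 0 * dual v j 0 * low j) - dual w i 0 * dual v j 0 * high j
     + p * (low i * v i 0 * w j 0) = 0).
Proof.
have E (A B : 'M[R]_n) : A = B <-> forall i j, (A - B) i j = 0.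
  split=> [-> i j|AB]; first by rewrite subrr mxE.
  apply/eqP; rewrite -subr_eq0; apply/eqP/matrixP => i j.
  by rewrite AB mxE.
have S1 : (w^T *m highm *m dual w) 0 0 =
          \sum_(a < n - 2 * l) w (mid_ord a) 0 * dual w (mid_ord a) 0.
  rewrite mul_mx_diag mxE (sum_low_mid l2n) big1 ?add0r => [|i il].
    by apply: eq_bigr => j _; rewrite !mxE mid_low mulr1.
  by rewrite !mxE il mulr0 mul0r.
have S2 : ((dual v)^T *m lowm *m v) 0 0 = 0.
  rewrite mul_mx_diag mxE (sum_low_mid l2n) [X in _ + X]big1 ?addr0 => [|j _].
    rewrite -[RHS](dual_orthogonal v); apply: eq_bigr => i il.
    rewrite [X in X * _ = _]mxE [X in X * _ * _ = _]mxE.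
    by rewrite [X in _ * X * _ = _]mxE il mulr1.
  by rewrite [X in X * _]mxE [X in _ * X * _]mxE mid_low mulr0 mul0r.
rewrite /inclusions !E /modX /modY !rank1_inclusion S1 S2 scale0r.
have T (x y : 'cV[R]_n) i j : (x *m y^T) i j = x i 0 * y j 0.
  by rewrite mxE big_ord1 !mxE.
have addE (A B : 'M[R]_n) i j : (A + B) i j = A i j + B i j by rewrite mxE.
have oppE (A : 'M[R]_n) i j : (- A) i j = - A i j by rewrite mxE.
have scaleE a (A : 'M[R]_n) i j : (a *: A) i j = a * A i j by rewrite mxE.
have lowL (x : 'cV[R]_n) i : (lowm *m x) i 0 = low i * x i 0.
  by rewrite mul_diag_mx mxE; congr (_ * _); rewrite mxE.
have highL (x : 'cV[R]_n) i : (highm *m x) i 0 = high i * x i 0.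
  by rewrite mul_diag_mx mxE; congr (_ * _); rewrite mxE.
have lowR (A : 'M[R]_n) i j : (A *m lowm) i j = A i j * low j.
  by rewrite mul_mx_diag mxE; congr (_ * _); rewrite mxE.
have highR (A : 'M[R]_n) i j : (A *m highm) i j = A i j * high j.
  by rewrite mul_mx_diag mxE; congr (_ * _); rewrite mxE.
pose X := (addE, oppE, scaleE, lowR, highR, T, lowL, highL).
by split=> -[H1 H2]; split=> i j; have := H1 i j; have := H2 i j;
  rewrite ?subr0 ?X.
Qed.

(** * From admissible pairs to the inclusion conditions *)

Section Sufficiency.

Variables (v : 'cV[R]_n) (z : 'cV[R]_(n - 2 * l)).
Hypothesis vz : admissible v z.

Local Notation w := (cofactor_of v z).
Local Notation r := (half_square z).

(** On the low block M^T squares to -1. *)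
Lemma dual_cofactor_low (i : 'I_n) : (i < 2 * l)%N ->
  dual w i 0 = - (r * v i 0).
Proof.
move=> il; rewrite dual_low // cofactor_low ?flip_low // dualE flipK //.
by rewrite mulrCA [X in _ * X]mulrA sgn_sqr mul1r.
Qed.

Lemma dual_cofactor_mid j : dual w (mid_ord j) 0 = - z (rev_ord j) 0.
Proof. by rewrite dual_mid cofactor_mid. Qed.

(** Write 2p as z^T V_2. The rank relation turns each product z_a v_a z_j into z_a z_(rev a) v_(rev
    j), and the sum over a is 2r. This identity settles every mixed entry of the inclusions. *)
Lemma half_square_mid j : p * z j 0 = r * v (mid_ord (rev_ord j)) 0.
Proof.
have [vz1 vz2] := vz; apply: two_mulI;
  rewrite [LHS]mulrA [RHS]mulrA -vz2 half_squareE !mulr_suml.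
apply: eq_bigr => a _; have := vz1 (rev_ord j) a; rewrite rev_ordK !mxE => E.
by rewrite -[RHS]mulrA [X in _ = _ * X]mulrC E; ring.
Qed.

(** The low part of w is r times that of M^T v, hence orthogonal to v; the high part contributes z^T
    V_2. *)
Lemma cofactor_dot : (w^T *m v) 0 0 = 2%:R * p.
Proof.
have [_ <-] := vz; rewrite mxE (sum_low_mid l2n) -[RHS]add0r; congr (_ + _).
  rewrite -[RHS](mulr0 r) -[X in _ = _ * X](dual_orthogonal v) mulr_sumr.
  by apply: eq_bigr => i il; rewrite [X in X * _]mxE cofactor_low // mulrA.
by apply: eq_bigr => j _; rewrite [X in X * _]mxE cofactor_mid mxE.
Qed.

Lemma cofactor_inclusions : inclusions v w.
Proof.
have S : \sum_(a < n - 2 * l) w (mid_ord a) 0 * dual w (mid_ord a) 0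
  = - (2%:R * r).
  rewrite half_squareE -sumrN; apply: eq_bigr => a _.
  by rewrite cofactor_mid dual_cofactor_mid mulrN.
apply/inclusionsP; rewrite S; split=> i j.
  case: (low_or_mid l2n i) (low_or_mid l2n j) => [il|[a ->]] [jl|[b ->]];
    rewrite ?mid_low ?il ?jl ?cofactor_mid ?dual_cofactor_mid ?cofactor_low
      ?dual_cofactor_low //= ?mulr0n ?mulr1n.
  - ring.
  - transitivity (v i 0 * (p * z b 0 - r * v (mid_ord (rev_ord b)) 0)).
      by rewrite dual_mid; ring.
    by rewrite half_square_mid subrr mulr0.
  - transitivity (- (dual v j 0 * (p * z (rev_ord a) 0 - r * v (mid_ord a) 0))).
      by ring.
    by rewrite half_square_mid rev_ordK subrr mulr0 oppr0.
  - transitivity (v (mid_ord a) 0 * (p * z b 0 - r * v (mid_ord (rev_ord b)) 0)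
      + v (mid_ord (rev_ord b)) 0 * (p * z (rev_ord a) 0
          - r * v (mid_ord a) 0)).
      by rewrite dual_mid; ring.
    by rewrite !half_square_mid rev_ordK !subrr !mulr0 addr0.
case: (low_or_mid l2n i) (low_or_mid l2n j) => [il|[a ->]] [jl|[b ->]];
  rewrite ?mid_low ?il ?jl ?cofactor_mid ?dual_cofactor_mid ?cofactor_low
    ?dual_cofactor_low //= ?mulr0n ?mulr1n.
- ring.
- transitivity (v i 0 * (p * z b 0 - r * v (mid_ord (rev_ord b)) 0)).
    by rewrite dual_mid; ring.
  by rewrite half_square_mid subrr mulr0.
- transitivity (- (dual v j 0 * (p * z (rev_ord a) 0 - r * v (mid_ord a) 0))).
    by ring.
  by rewrite half_square_mid rev_ordK subrr mulr0 oppr0.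
(* The high block of the second inclusion is the rank relation itself. *)
- have E := vz.1 a (rev_ord b); rewrite rev_ordK !mxE in E.
  transitivity (v (mid_ord a) 0 * z b 0
    - v (mid_ord (rev_ord b)) 0 * z (rev_ord a) 0).
    by rewrite dual_mid; ring.
  by rewrite E subrr.
Qed.

End Sufficiency.

(** * From the inclusion conditions to admissible pairs *)

Section Necessity.

Variables (v w : 'cV[R]_n) (i0 : 'I_n).
Hypothesis vi0 : v i0 0 = 1.
Hypothesis wv : (w^T *m v) 0 0 = 2%:R * p.
Hypothesis vw : inclusions v w.

Local Notation s := (\sum_(a < n
  - 2 * l) w (mid_ord a) 0 * dual w (mid_ord a) 0).

Lemma inclusions_mid (a b : 'I_(n - 2 * l)) :
  v (mid_ord a) 0 * w (mid_ord b) 0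
    = w (mid_ord (rev_ord a)) 0 * v (mid_ord (rev_ord b)) 0.
Proof.
have [_ /(_ (mid_ord a) (mid_ord b))] := (inclusionsP v w).1 vw.
rewrite !mid_low !dual_mid /= => /eqP E; apply/eqP; rewrite -subr_eq0 -(eqP E).
by apply/eqP; ring.
Qed.

(** The multiple c is left arbitrary: for a high i0 it appears as p u before it is known to be r. *)
Lemma dot_low c : (forall i : 'I_n, (i < 2 * l)%N -> w i 0 = c * dual v i 0) ->
  \sum_j w (mid_ord j) 0 * mid v j 0 = 2%:R * p.
Proof.
move=> wc; rewrite -wv mxE (sum_low_mid l2n) -[LHS]add0r; congr (_ + _).
  rewrite -[LHS](mulr0 c) -[X in _ * X = _](dual_orthogonal v) mulr_sumr.
  by apply: eq_bigr => i il; rewrite [X in _ = X * _]mxE wc // mulrA.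
by apply: eq_bigr => j _; rewrite [X in _ = X * _]mxE mxE.
Qed.

Lemma low_dual c : (forall i : 'I_n, (i < 2 * l)%N ->
  dual w i 0 = - (c * v i 0)) ->
  forall i : 'I_n, (i < 2 * l)%N -> w i 0 = c * dual v i 0.
Proof.
move=> wc i il; have := wc (flip l i);
  rewrite flip_low // dualE flipK // => /(_ il).
move/(congr1 ( *%R (sgn l R i))); rewrite mulrA sgn_sqr mul1r => ->.
by rewrite dual_low //; ring.
Qed.

Lemma half_square_dual : half_square (mid w) = - (half * s).
Proof.
apply: two_mulI; rewrite half_squareE mulrN mulrA halfE mul1r -sumrN.
by apply: eq_bigr => a _; rewrite dual_mid !mxE mulrN opprK.
Qed.

Lemma inclusions_dual_low (i : 'I_n) : (i < 2 * l)%N ->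
  dual w i 0 = - (half_square (mid w) * v i 0).
Proof.
move: i; have [H1 H2] := (inclusionsP v w).1 vw.
have [i0l|[j0 i0j]] := low_or_mid l2n i0.
  (* The low block of the first inclusion says that [dual w] v^T + v [dual w]^T
     is a multiple of v v^T; the unit entry of v then determines [dual w]. *)
  have E (i j : 'I_n) : (i < 2 * l)%N -> (j < 2 * l)%N ->
      dual w i 0 * v j 0 + dual w j 0 * v i 0 = s * (v i 0 * v j 0).
    move=> il jl; have jl' : (flip l j < 2 * l)%N by rewrite flip_low.
    have := H1 i (flip l j); rewrite il jl' /=
      (dual_low v jl') flipK // sgn_flip_low //.
    have -> : w (flip l j) 0 = - (sgn l R j * dual w j 0).
      by rewrite (dual_low w jl) mulrN opprK mulrA sgn_sqr mul1r.
    move: s => c /(congr1 ( *%R (sgn l R j))); rewrite [RHS]mulr0 => E.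
    apply/eqP; rewrite -subr_eq0 -E; apply/eqP.
    transitivity (sgn l R j * sgn l R j * (dual w i 0 * v j 0
      + dual w j 0 * v i 0 - c * (v i 0 * v j 0))).
      by rewrite sgn_sqr mul1r.
    by ring.
  (* On the diagonal the two summands coincide, so the relation reads 2 (M^T w)_(i0) = s. *)
  have E0 : dual w i0 0 = half * s.
    have := E i0 i0 i0l i0l; rewrite vi0 !mulr1 => E0.
    by apply: two_mulI; rewrite [RHS]mulrA halfE mul1r -E0 mulr_natl mulr2n.
  move=> i il; have := E i i0 il i0l;
    rewrite vi0 E0 !mulr1 half_square_dual => E1.
  have -> : dual w i 0 = s * v i 0 - half * s * v i 0 by rewrite -E1 addrK.
  transitivity (2%:R * half * (s * v i 0) - half * s * v i 0);
    first by rewrite halfE mul1r.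
  ring.
move=> i il.
(* Now V_2 has entry 1 at j0. Row j0 of the rank relation gives z = u H V_2, and the column of the
   second inclusion at the reversed index gives M^T w = -p u v on the low entries. *)
pose u : R := w (mid_ord (rev_ord j0)) 0.
have wE (j : 'I_(n - 2 * l)) : w (mid_ord j) 0 = u * v (mid_ord (rev_ord j)) 0.
  by have := inclusions_mid j0 j; rewrite -i0j vi0 mul1r.
have dE (i1 : 'I_n) : (i1 < 2 * l)%N -> dual w i1 0 = - (p * u * v i1 0).
  move=> il1; have := H2 i1 (mid_ord (rev_ord j0)).
  rewrite il1 mid_low dual_mid rev_ordK -i0j vi0 -/u /= => E.
  by apply/eqP; rewrite -subr_eq0 -E; apply/eqP; ring.
(* Indeed 2r = z^T H z = u (z^T V_2) = 2 p u. *)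
have sE : half_square (mid w) = p * u.
  apply: two_mulI; rewrite half_squareE mulrA -(dot_low
    (low_dual dE)) mulr_suml.
  apply: eq_bigr => a _; rewrite !mxE [X in _ * X]wE rev_ordK; ring.
by rewrite sE dE.
Qed.

Lemma inclusions_admissible : admissible v (mid w).
Proof.
split=> [i j|].
  have := inclusions_mid i (rev_ord j); rewrite rev_ordK !mxE => ->;
    exact: mulrC.
rewrite -(dot_low (low_dual inclusions_dual_low)).
by apply: eq_bigr => j _; rewrite [mid w j 0]mxE.
Qed.

Lemma inclusions_factorE : w = cofactor_of v (mid w).
Proof.
apply/matrixP => i j; rewrite ord1 {j}.
have [il|[j ->]] := low_or_mid l2n i; last by rewrite cofactor_mid mxE.
by rewrite cofactor_low // (low_dual inclusions_dual_low).
Qed.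

End Necessity.

End InclusionConditions.

(** * The matrices of the lattices *)

Section ToIntegers.

Variables (K : fieldType) (v : valuation K).

Lemma to_integersK (x : integers v) : to_integers v (\val x) = x.
Proof. exact: valKd. Qed.

Lemma val_uniformizer pi : uniformizer v pi -> \val (to_integers v pi) = pi.
Proof. by move=> [_ v1]; rewrite insubdK // inE v1 orbT. Qed.

Lemma val_to_integers x : v x = 0 -> \val (to_integers v x) = x.
Proof. by move=> v1; rewrite insubdK // inE v1 lexx orbT. Qed.

End ToIntegers.

Section Lattices.

Variables (F0 : fieldType) (v0 : valuation F0).
Variables (F : fieldExtType F0) (vF : valuation F) (pi : F).
Hypothesis dimF : \dim {:F} = 2%N.
Hypothesis ramF : forall x : F0, x != 0 -> vF (x%:A) = 2 * v0 x.
Hypothesis hpi : uniformizer vF pi.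
Variable pi0 : F0.
Hypothesis pi_sqr : pi ^+ 2 = pi0%:A.
Variables (n : nat) (V : vectType F) (e : n.-tuple V) (l : nat).
Hypothesis he : basis_of {:V} e.
Hypothesis l_le : (l <= n./2)%N.

Local Notation OF := (integers vF).
Local Notation piO := (to_integers vF pi).

Lemma coordinate_full (g : 'I_n -> V) (c : F0) i j :
    basis_of {:V} [tuple g a | a < n] ->
  coordinate pi g i (c%:A *: full pi g j) = c *+ (i == j).
Proof.
move=> bg; have f1 : free [tuple 1;
  pi] := basis_free (free_1pi dimF ramF hpi he l_le).
have cg a b : coord [tuple g a | a < n] a (g b) = (a == b)%:R.
  rewrite -[g b](tnth_mktuple g) (tnth_nth 0) coord_free ?(eq_sym b) //.
  exact: basis_free bg.
have [c1 c2] : coord [tuple 1; pi] 0 1 = 1 /\ coord [tuple 1; pi] 1 1 = 0.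
  by split; rewrite (coord_free ord0 _ f1).
have [c3 c4] : coord [tuple 1; pi] 0 pi = 0 /\ coord [tuple 1; pi] 1 pi = 1.
  by split; rewrite (coord_free 1 _ f1).
rewrite /coordinate /full; case: (split_ordP i) => a ->;
  case: (split_ordP j) => b ->;
  rewrite ?(unsplitK (inl _)) ?(unsplitK (inr _)) ?eq_lshift ?eq_rshift
    ?eq_lrshift ?eq_rlshift ?mulr0n !linearZ /= ?cg ?mulr_algl linearZ /=.
all: by case: (a == b);
  rewrite ?mulr1 ?mulr0 ?c1 ?c2 ?c3 ?c4 ?linear0 ?mulr0 ?mulr1 ?mulr1n.
Qed.

Lemma to_integers_bool (c : F0) (b : bool) :
  to_integers vF ((c *+ b)%:A) = to_integers vF c%:A *+ b.
Proof. by case: b => //; rewrite !mulr0n scale0r;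
  exact: (to_integersK (0 : OF)). Qed.

Lemma to_integers_scale1 : to_integers vF (1%:A) = 1.
Proof. by rewrite scale1r; exact: (to_integersK (1 : OF)). Qed.

Lemma to_integers_pi0 : to_integers vF pi0%:A = piO ^+ 2.
Proof. by rewrite -[RHS]to_integersK rmorphXn /=
  (val_uniformizer hpi) pi_sqr. Qed.

(** This covers multiplication by pi and both inclusions: each multiplies the b-th vector by 1 or
    pi, as [P] tells. A factor pi moves the first half of the basis to the second, and the second to
    pi^2 = pi0 times the first. *)
Lemma lattice_mx_block (f g : 'I_n -> V) (h : V -> V) (P : pred 'I_n) :
    basis_of {:V} [tuple g a | a < n] ->
    (forall b, h (f b) = (if P b then 1 else pi) *: g b) ->
    (forall x, h (pi *: x) = pi *: h x) ->
  lattice_mx vF pi f g h =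
    block_mx (diag_mx (\row_b (P b)%:R)) (piO ^+ 2 *: diag_mx (\row_b
      (~~ P b)%:R))
             (diag_mx (\row_b (~~ P b)%:R)) (diag_mx (\row_b (P b)%:R)).
Proof.
move=> bg hf hpil; pose tgt (j : 'I_(n + n)) : F0 * 'I_(n + n) :=
  match split j with
  | inl b => (1, if P b then lshift n b else rshift n b)
  | inr b => if P b then (1, rshift n b) else (pi0, lshift n b)
  end.
have hfull j : h (full pi f j) = (tgt j).1%:A *: full pi g (tgt j).2.
  rewrite /full /tgt; case: (split j) => b.
    rewrite hf /= !scale1r.
    by case: ifP => _; rewrite ?(unsplitK (inl b)) ?(unsplitK (inr b)) ?scale1r.
  rewrite hpil hf.
  case: ifP => _ /=; rewrite ?(unsplitK (inl b)) ?(unsplitK (inr b))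
    ?scale1r //.
  by rewrite scalerA -expr2 pi_sqr.
apply/matrixP => i j; rewrite mxE hfull coordinate_full // to_integers_bool.
rewrite /tgt; case: (split_ordP i) => a ->; case: (split_ordP j) => b ->;
  rewrite ?(unsplitK (inl b)) ?(unsplitK (inr b)) ?block_mxEul ?block_mxEur
    ?block_mxEdl ?block_mxEdr !mxE; have [->|ab] := eqVneq a b;
      case: (P b) => /=;
  rewrite ?eq_lshift ?eq_rshift ?eq_lrshift ?eq_rlshift ?(negPf ab) ?eqxx
    ?mulr0n
    ?mul0rn ?mulr0 ?mulr1n ?mulr1 ?to_integers_scale1 ?to_integers_pi0 //.
Qed.

Lemma basis_scale (f : 'I_n -> V) (c : F) : c != 0 ->
  basis_of {:V} [tuple f a | a < n] -> basis_of {:V} [tuple c *: f a | a < n].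
Proof.
move=> c0 bf; have dimV := vector.size_basis bf.
rewrite basisEdim size_tuple dimV leqnn andbT -(span_basis bf).
apply/span_subvP => x /tnthP[j ->].
rewrite tnth_mktuple -[f j]scale1r -(mulVf c0) -scalerA.
by apply/memvZ/memv_span/tnthP; exists j; rewrite tnth_mktuple.
Qed.

Lemma half_l_basis : basis_of {:V} [tuple half_l pi e l a | a < n].
Proof.
have [s [s_inj fE _]] := halfE pi dimF he l_le.
exact: (half_basis hpi he s_inj fE).1.
Qed.

Lemma half_nl_basis : basis_of {:V} [tuple half_nl pi e l a | a < n].
Proof.
have [s [s_inj _ fE]] := halfE pi dimF he l_le.
exact: (half_basis hpi he s_inj fE).1.
Qed.

Lemma half_l_nl b :
  half_l pi e l b = (if (b < 2 * l)%N then 1 else pi) *: half_nl pi e l b.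
Proof.
have [pi_neq0 _] := hpi; rewrite /half_l /half_nl.
have [bl|bl] := ltnP b l; first by rewrite ifT ?scale1r //; lia.
by case: ifP => _; rewrite ?scale1r // scalerA divff // scale1r.
Qed.

Lemma mulpi_mx (f : 'I_n -> V) : basis_of {:V} [tuple f a | a < n] ->
  lattice_mx vF pi f f (fun x => pi *: x) = block_mx 0 (piO ^+ 2)%:M 1%:M 0.
Proof.
move=> bf; rewrite (@lattice_mx_block f f _ pred0) //=.
congr block_mx; apply/matrixP => i j; rewrite !mxE ?mul0rn //.
by rewrite mulrnAr mulr1.
Qed.

Lemma incl_l_nlE : incl_l_nl vF pi e l =
  block_mx (lowmx n l OF) (piO ^+ 2 *: highmx n l OF) (highmx n l OF)
    (lowmx n l OF).
Proof.
apply: (@lattice_mx_block _ _ _ (fun b : 'I_n => (b < 2 * l)%N)) => //.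
  exact: half_nl_basis.
exact: half_l_nl.
Qed.

(** Against the basis pi^-1 [half_l], the factor pi falls on the low vectors, so the two projections
    exchange roles. *)
Lemma incl_nl_lE : incl_nl_l vF pi e l =
  block_mx (highmx n l OF) (piO ^+ 2 *: lowmx n l OF) (lowmx n l OF)
    (highmx n l OF).
Proof.
have [pi_neq0 _] := hpi.
have -> : lowmx n l OF = diag_mx (\row_b (~~ ~~ (b < 2 * l)%N)%:R).
  by congr diag_mx; apply/rowP => b; rewrite !mxE negbK.
apply: (@lattice_mx_block _ _ _ (fun b : 'I_n => ~~ (b < 2 * l)%N)) => //.
  by apply: basis_scale half_l_basis; rewrite invr_eq0.
move=> b; rewrite half_l_nl !scalerA.
by case: (b < 2 * l)%N; rewrite ?mulr1 ?mul1r ?(divff pi_neq0)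
  ?(mulVf pi_neq0) scale1r.
Qed.

(** * The Gram matrix *)

Variables (bar : 'AEnd(F)) (phi : V -> V -> F).
Hypothesis bar_nontrivial : exists a : F, bar a != a.
Hypothesis phi_split : split_basis bar phi e.
Hypothesis two_neq0 : (2%:R : F0) != 0.

Lemma bar_alg (c : F0) : bar c%:A = c%:A.
Proof. by rewrite linearZ rmorph1. Qed.

(** Conjugation preserves pi^2, so it sends pi to pi or -pi; the former would fix the basis 1, pi of
    F and make [bar] trivial. *)
Lemma bar_pi : bar pi = - pi.
Proof.
have : (bar pi - pi) * (bar pi + pi) == 0.
  by rewrite -subr_sqr -rmorphXn /= pi_sqr bar_alg subrr.
rewrite mulf_eq0 subr_eq0 addr_eq0 => /orP[/eqP bpi|/eqP //].
have [a /negP[]] := bar_nontrivial; apply/eqP.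
rewrite (pair_coord dimF ramF hpi he l_le a).
by rewrite linearD !linearZ /= rmorph1 bpi.
Qed.

Lemma bilin_alg x y (c : F0) : phi x y = c%:A -> bilin bar phi x y = c.
Proof.
move=> E; rewrite /bilin /trace E bar_alg -mulr2n -scaler_nat linearZ linearZ
  /=.
have f1 : free [tuple (1 : F)] by rewrite seq1_free oner_neq0.
by rewrite (coord_free 0 0 f1) eqxx mulr1 mulKf.
Qed.

Lemma bilin_anti x y : bar (phi x y) = - phi x y -> bilin bar phi x y = 0.
Proof. by move=> E; rewrite /bilin /trace E subrr linear0 mulr0. Qed.

Lemma phi_basis (x y : F) (i j : nat) : (i < n)%N -> (j < n)%N ->
  phi (x *: e`_i) (y *: e`_j) = bar x * y *+ (i + j == n.-1)%N.
Proof.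
move=> hi hj; have [_ ph] := phi_split.
have := ph (Ordinal hi) (rev_ord (Ordinal hj)) x y.
rewrite rev_ordK !(tnth_nth 0) /= mulr_natr => ->; congr (_ *+ nat_of_bool _).
by apply/eqP/eqP => [/(congr1 val) /=|E]; [|apply: val_inj => /=]; lia.
Qed.

Lemma phi_half a b : phi (half_nl pi e l a) (half_l pi e l b) =
  sgn l F a * pi^-1 *+ (b == flip l a).
Proof.
have l2n : (2 * l <= n)%N by have := l_le; have := odd_double_half n; lia.
(* [pos] is the zero-based index in [e] of the c-th vector. Two vectors pair when their indices add
   up to n - 1, and exactly one of such a pair carries pi^-1. *)
pose pos (c : 'I_n) := (if c < l then n - l + c else c - l)%N.
have pos_lt c : (pos c < n)%N by rewrite /pos; have := ltn_ord c; case: ifP;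
  lia.
have nlE : half_nl pi e l a = (if (a < l)%N then 1 else pi^-1) *: e`_(pos a).
  by rewrite /half_nl /pos; case: ifP => _; rewrite ?scale1r ?if_same.
have lE : half_l pi e l b =
    (if (l <= b)%N && (b < 2 * l)%N then pi^-1 else 1) *: e`_(pos b).
  by rewrite /half_l /pos (leqNgt l b); case: (b < l)%N; case: (b < 2 * l)%N;
    rewrite /= ?scale1r.
rewrite nlE lE phi_basis //.
have -> : (pos a + pos b == n.-1)%N = (b == flip l a).
  have E : (b == flip l a) = (b == flip l a :> nat) by [].
  have := ltn_ord a; have := ltn_ord b.
  rewrite E val_flip // /pos; case: ifP => bl; case: ifP => al;
    case: ifP => a2l; lia.
case: eqVneq => // ->; rewrite !mulr1n /sgn val_flip //.
case: ifP => al; [rewrite ifT|rewrite ifF]; rewrite ?rmorph1 ?mul1r //.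
- by have := ltn_ord a; case: ifP; lia.
- by rewrite fmorphV /= bar_pi invrN mulr1 mulN1r.
- by have := ltn_ord a; case: ifP; lia.
Qed.

Hypothesis phi_hermitian : hermitian_form bar phi.

Lemma phiZr x c y : phi x (c *: y) = c * phi x y.
Proof.
have [lin _] := phi_hermitian.
have phi0 : phi x 0 = 0.
  by have /eqP := lin x 1 0 0;
    rewrite scaler0 addr0 mul1r -subr_eq0 opprD addNKr oppr_eq0 => /eqP.
by rewrite -[c *: y]addr0 lin phi0 addr0.
Qed.

Lemma phiZl x c y : phi (c *: x) y = bar c * phi x y.
Proof.
have [_ sym] := phi_hermitian.
by rewrite sym phiZr rmorphM /= -sym.
Qed.

(** On the first halves phi takes values in F0 pi^-1. A factor pi on one side brings them into F0,
    on both sides into F0 pi; the trace kills the odd powers of pi. In the first argument pi is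
    conjugated, whence the sign of the lower left block. *)
Lemma gramE : gram vF pi bar phi e l =
  block_mx 0 (pairing n l OF) (- pairing n l OF) 0.
Proof.
have [pi_neq0 _] := hpi.
have sgnE i : sgn l F i = (sgn l F0 i)%:A.
  by rewrite /sgn; case: ifP; rewrite ?scaleN1r ?scale1r.
have to_sgn i (b : bool) : to_integers vF ((sgn l F0 i *+ b)%:A)
  = sgn l OF i *+ b.
  rewrite to_integers_bool -sgnE /sgn; case: ifP => _; congr (_ *+ b).
    exact: (to_integersK (1 : OF)).
  exact: (to_integersK (-1 : OF)).
have to_sgnN i (b : bool) :
    to_integers vF ((- (sgn l F0 i *+ b))%:A) = - (sgn l OF i *+ b).
  rewrite -mulNrn -[RHS]mulNrn to_integers_bool scaleNr -sgnE /sgn.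
  case: ifP => _; rewrite ?opprK; congr (_ *+ b).
    exact: (to_integersK (-1 : OF)).
  exact: (to_integersK (1 : OF)).
have to0 : to_integers vF (0%:A) = 0 by rewrite scale0r;
  exact: (to_integersK (0 : OF)).
have bars i : bar (sgn l F i) = sgn l F i by rewrite sgnE bar_alg.
apply/matrixP => i j; rewrite mxE /full.
case: (split_ordP i) => a ->; case: (split_ordP j) => b ->;
  rewrite ?(unsplitK (inl a)) ?(unsplitK (inr a)) ?(unsplitK (inl b))
    ?(unsplitK (inr b))
    ?block_mxEul ?block_mxEur ?block_mxEdl ?block_mxEdr !mxE.
- rewrite bilin_anti // phi_half rmorphMn rmorphM fmorphV /= bars bar_pi.
  by rewrite invrN mulrN mulNrn.
- rewrite (@bilin_alg _ _ (sgn l F0 a *+ (b == flip l a))) ?to_sgn //.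
  rewrite phiZr phi_half mulrnAr mulrCA divff // mulr1 sgnE.
  by rewrite -!scaler_nat scalerA mulr_natl.
- rewrite (@bilin_alg _ _ (- (sgn l F0 a *+ (b == flip l a)))) ?to_sgnN //.
  rewrite phiZl bar_pi phi_half mulNr mulrnAr mulrCA divff // mulr1 sgnE.
  by rewrite scaleNr -!scaler_nat scalerA mulr_natl.
- rewrite bilin_anti // phiZr phiZl phi_half bar_pi mulNr mulrnAr mulrCA divff
    // mulr1.
  rewrite mulrN rmorphN rmorphM rmorphMn /= bars bar_pi; ring.
Qed.

End Lattices.

(** * Quotients of polynomial algebras *)

Section QuotientLift.

Variables (O : comNzRingType) (P R : comAlgType O) (g : relations P).
Local Notation Q := (quotient_algebra g).
Local Notation piQ := (\pi_{ideal_quot (relations_ideal g)}).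

Definition quotient_map : P -> Q := piQ.

Lemma quotient_mapK (x : Q) : quotient_map (repr x) = x.
Proof. exact: reprK. Qed.

Lemma quotient_map_zmod : zmod_morphism quotient_map.
Proof. exact: rmorphB. Qed.

Lemma quotient_map_monoid : monoid_morphism quotient_map.
Proof. by split; [exact: rmorph1|exact: rmorphM]. Qed.

Lemma quotient_map_scalable : scalable quotient_map.
Proof. by move=> a p; rewrite -mulr_algl quotient_map_monoid.2. Qed.

HB.instance Definition _ :=
  GRing.isZmodMorphism.Build P Q quotient_map quotient_map_zmod.
HB.instance Definition _ :=
  GRing.isMonoidMorphism.Build P Q quotient_map quotient_map_monoid.
HB.instance Definition _ :=
  GRing.isScalable.Build O P Q *:%R quotient_map quotient_map_scalable.

Lemma quotient_map_eq p q : quotient_map p = quotient_map q <->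
  p - q \in ideal_span g.
Proof.
rewrite -[_ \in _]/(p - q \in relations_ideal g) Quotient.idealrBE.
by split=> [/eqP|/eqP].
Qed.

Lemma quotient_map_eq0 p : g p -> quotient_map p = 0.
Proof.
move=> gp; rewrite -(rmorph0 quotient_map); apply/quotient_map_eq;
  rewrite subr0.
by apply/asboolP; exists 1%N, (fun=> 1), (fun=> p); split=> //;
  rewrite big_ord1 mul1r.
Qed.

Variable f : {lrmorphism P -> R}.
Hypothesis gf : forall p, g p -> f p = 0.

(** The proof is an argument so that the morphism instances below can be inferred from the term. *)
Definition quotient_lift of (forall p, g p -> f p = 0) : Q -> R :=
  fun x => f (repr x).

Local Notation lift := (quotient_lift gf).

Lemma ideal_span_ker p : p \in ideal_span g -> f p = 0.
Proof.
move=> /asboolP[s [a [b [gb ->]]]]; rewrite rmorph_sum big1 //= => i _.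
by rewrite rmorphM /= (gf (gb i)) mulr0.
Qed.

Lemma quotient_liftE p : lift (quotient_map p) = f p.
Proof.
apply/eqP; rewrite -subr_eq0 -rmorphB; apply/eqP/ideal_span_ker/quotient_map_eq.
exact: quotient_mapK.
Qed.

Lemma quotient_lift_zmod : zmod_morphism lift.
Proof.
move=> x y; rewrite -(quotient_mapK x) -(quotient_mapK y) -rmorphB
  !quotient_liftE.
exact: rmorphB.
Qed.

Lemma quotient_lift_monoid : monoid_morphism lift.
Proof.
split=> [|x y]; first by rewrite -(rmorph1 quotient_map) quotient_liftE rmorph1.
rewrite -(quotient_mapK x) -(quotient_mapK y) -rmorphM !quotient_liftE;
  exact: rmorphM.
Qed.

Lemma quotient_lift_scalable : scalable lift.
Proof.
move=> a x; rewrite -(quotient_mapK x) -linearZ !quotient_liftE; exact: linearZ.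
Qed.

HB.instance Definition _ := GRing.isZmodMorphism.Build Q R lift
  quotient_lift_zmod.
HB.instance Definition _ := GRing.isMonoidMorphism.Build Q R lift
  quotient_lift_monoid.
HB.instance Definition _ := GRing.isScalable.Build O Q R *:%R lift
  quotient_lift_scalable.

Lemma quotient_lift_ex :
  exists h : {lrmorphism Q -> R}, forall p, h (quotient_map p) = f p.
Proof. by exists lift; exact: quotient_liftE. Qed.

End QuotientLift.

Section MpolyQuotient.

Variables (O : comNzRingType) (N : nat) (R : comAlgType O).

Section Evaluation.

Variable x : 'I_N -> R.

Definition mpoly_eval : {mpoly O[N]} -> R := mmap (in_alg R) x.

HB.instance Definition _ := GRing.RMorphism.on mpoly_eval.

Lemma mpoly_eval_scalable : scalable mpoly_eval.
Proof. by move=> c p; rewrite /mpoly_eval mmapZ /= mulr_algl. Qed.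

HB.instance Definition _ :=
  GRing.isScalable.Build O {mpoly O[N]} R *:%R mpoly_eval mpoly_eval_scalable.

Lemma mpoly_evalX i : mpoly_eval 'X_i = x i.
Proof. by rewrite /mpoly_eval mmapX mmap1U. Qed.

Lemma mpoly_evalC c : mpoly_eval c%:MP = c%:A.
Proof. by rewrite /mpoly_eval mmapC. Qed.

End Evaluation.

Variable g : relations {mpoly O[N]}.

Local Notation Q := (quotient_algebra g).

Lemma mpoly_quotient_ex x : (forall p, g p -> mpoly_eval x p = 0) ->
  exists h : {lrmorphism Q -> R}, forall p, h (quotient_map g p)
    = mpoly_eval x p.
Proof.
move=> gx; have [h hE] := @quotient_lift_ex _ _ _ _ (mpoly_eval x) gx.
by exists h => p; rewrite hE.
Qed.

Lemma mpoly_quotient_ext (h h' : {lrmorphism Q -> R}) :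
  (forall i, h (quotient_map g 'X_i) = h' (quotient_map g 'X_i)) -> h =1 h'.
Proof.
have hP (k : {lrmorphism Q -> R}) a p q :
    k (quotient_map g (a *: p + q))
      = a *: k (quotient_map g p) + k (quotient_map g q).
  by rewrite !linearP.
move=> hX x; rewrite -(quotient_mapK x);
  elim/mpolyind: (repr x) => [|c m p _ _ IH].
  by rewrite !rmorph0.
rewrite !hP IH mpolyXE_id !rmorph_prod /=; congr (_ *: _ + _).
by apply: eq_bigr => i _; rewrite !rmorphXn /= hX.
Qed.

End MpolyQuotient.

(** * Points of the charts *)

Section LatticeMaps.

Variables (R : comNzRingType) (n : nat) (p : R).
Implicit Types (A B D : 'M[R]_n).

(* The action of t on a lattice, in a basis (f_a, pi f_a). *)
Definition shift_mx : 'M[R]_(n + n) := block_mx 0 (p ^+ 2)%:M 1%:M 0.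

Lemma shift_graph A : A *m A = (p ^+ 2)%:M ->
  shift_mx *m graph A = graph A *m A.
Proof.
move=> A2; rewrite graph_mul A2 mul_block_col !mul0mx !mulmx1 mul1mx.
by rewrite add0r addr0.
Qed.

Lemma shift_graphD A c : A *m A = (p ^+ 2)%:M ->
  (shift_mx + c%:M) *m graph A = graph A *m (A + c%:M).
Proof.
by move=> A2; rewrite mulmxDl mulmxDr shift_graph // mul_scalar_mx
  mul_mx_scalar.
Qed.

Lemma shift_graphB A c : A *m A = (p ^+ 2)%:M ->
  (shift_mx - c%:M) *m graph A = graph A *m (A - c%:M).
Proof.
by move=> A2; rewrite mulmxBl mulmxBr shift_graph // mul_scalar_mx
  mul_mx_scalar.
Qed.

Definition incl_mx D D' : 'M[R]_(n + n) := block_mx D (p ^+ 2 *: D') D' D.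

(** The lower half D' A + D of the image of the graph must be its coefficient matrix, so the
    inclusion is an equation between upper halves. *)
Lemma incl_graph D D' A B :
  (forall x, colspan (graph A) x -> colspan (graph B) (incl_mx D D' *m x)) <->
  D *m A + p ^+ 2 *: D' = B *m (D' *m A + D).
Proof.
have E : incl_mx D D' *m graph A = col_mx (D *m A + p ^+ 2 *: D') (D' *m A + D).
  by rewrite mul_block_col !mulmx1.
split=> [AB|AB x [c ->]]; last first.
  by exists ((D' *m A + D) *m c); rewrite !mulmxA E graph_mul AB.
have /graph_cols : forall j,
    colspan (graph B) (col j (incl_mx D D' *m graph A)).
  move=> j; rewrite colE -mulmxA; apply: AB; by exists (delta_mx j 0).
by rewrite E col_mxKd graph_mul => /eq_col_mx[].
Qed.

(** With a and b the upper and lower halves of x, pairing with the graph gives a^T M - b^T M A. As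
    M^T inverts M, this vanishes when a = M A^T M^T b. *)
Lemma gram_graph (M : 'M[R]_n) A x : M *m M^T = 1%:M ->
  (forall y, colspan (graph A) y -> x^T *m block_mx 0 M (- M) 0 *m y = 0) <->
  colspan (graph (M *m A^T *m M^T)) x.
Proof.
move=> MM; have MM' : M^T *m M = 1%:M := mulmx1C MM.
have xE : x^T *m block_mx 0 M (- M) 0 *m graph A
    = (usubmx x)^T *m M - (dsubmx x)^T *m M *m A.
  rewrite -{1}(vsubmxK x) tr_col_mx -mulmxA mul_block_col mul_row_col.
  by rewrite !mul0mx mulmx1 add0r addr0 mulNmx mulmxN mulmxA.
have -> : (forall y, colspan (graph A) y ->
  x^T *m block_mx 0 M (- M) 0 *m y = 0)
    <-> (usubmx x)^T *m M = (dsubmx x)^T *m M *m A.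
  split=> [xA|E y [c ->]]; last by rewrite mulmxA xE E subrr mul0mx.
  apply/eqP; rewrite -subr_eq0 -xE; apply/eqP/matrixP => i j.
  have xAj : col j (x^T *m block_mx 0 M (- M) 0 *m graph A) = 0.
    by rewrite colE -mulmxA; apply: xA; exists (delta_mx j 0).
  by move/(congr1 (fun B : 'cV_1 => B i 0)): xAj; rewrite !mxE.
split=> [E|/graphP E].
  apply/graphP; rewrite graph_mul -{1}(vsubmxK x); congr col_mx.
  apply: trmx_inj; rewrite !trmx_mul !trmxK -[LHS]mulmx1 -MM mulmxA E.
  by rewrite !mulmxA.
have -> : usubmx x = M *m A^T *m M^T *m dsubmx x.
  by rewrite {1}E graph_mul col_mxKu.
by rewrite !trmx_mul !trmxK -!mulmxA MM' mulmx1.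
Qed.

(** The square of x y^T is 2p x y^T, which cancels the cross terms. By [shift_graph] this is
    stability under t. *)
Lemma rank1_sqr (x y : 'cV[R]_n) : (y^T *m x) 0 0 = 2%:R * p ->
  (x *m y^T - p%:M) *m (x *m y^T - p%:M) = (p ^+ 2)%:M.
Proof.
move=> yx; have E : x *m y^T *m (x *m y^T) = (2%:R * p) *: (x *m y^T).
  rewrite mulmxA -(mulmxA x) [y^T *m x]mx11_scalar yx mul_mx_scalar.
  by rewrite scalemxAl.
rewrite mulmxBl !mulmxBr E mul_mx_scalar !mul_scalar_mx.
move: (x *m y^T) => {E}A; apply/matrixP => i j; rewrite !mxE.
by case: (i == j); rewrite ?mulr1n ?mulr0n; ring.
Qed.

Lemma rank1_kernel (x y : 'cV[R]_n) : (y^T *m x) 0 0 = 2%:R * p ->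
  (x *m y^T - p%:M - p%:M) *m x = 0.
Proof.
move=> yx; rewrite -addrA mulmxDl -mulmxA [y^T *m x]mx11_scalar yx
  mul_mx_scalar.
by rewrite -opprD -raddfD /= -scaleN1r -scalemxAl mul_scalar_mx scaleN1r
  mulr_natl subrr.
Qed.

Lemma shift_wedge_top (x y : 'cV[R]_n) :
    (y^T *m x) 0 0 = 2%:R * p -> \det (x *m y^T - p%:M - p%:M) = 0 ->
  wedge_zero n (shift_mx - p%:M) (colspan (graph (x *m y^T - p%:M))).
Proof.
by move=> yx; apply: wedge_zero_det; apply/shift_graphB/rank1_sqr.
Qed.

Lemma shift_wedge2 (x y : 'cV[R]_n) : (y^T *m x) 0 0 = 2%:R * p ->
  wedge_zero 2 (shift_mx + p%:M) (colspan (graph (x *m y^T - p%:M))).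
Proof.
move=> yx; apply: (@wedge_zero_rank1 _ _ _ _ x y).
by rewrite shift_graphD ?subrK // rank1_sqr.
Qed.

Lemma shift_char_poly (x y : 'cV[R]_n) : (0 < n)%N ->
  (y^T *m x) 0 0 = 2%:R * p ->
  char_poly_on n shift_mx (colspan (graph (x *m y^T - p%:M)))
    (('X + p%:P) ^+ n.-1 * ('X - p%:P)).
Proof.
move=> n0 yx; apply: graph_char_poly_on; first by apply/shift_graph/rank1_sqr.
rewrite char_poly_rank1 // yx; congr (_ * _).
by rewrite rmorphM /= polyC_natr; ring.
Qed.

End LatticeMaps.

Section BaseChange.

Variables (R R' : comNzRingType) (f : {rmorphism R -> R'}) (n l : nat).

Lemma map_sgn (i : 'I_n) : f (sgn l R i) = sgn l R' i.
Proof. by rewrite /sgn; case: ifP => _; rewrite ?rmorphN ?rmorph1. Qed.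

Lemma map_pairing : map_mx f (pairing n l R) = pairing n l R'.
Proof. by apply/matrixP => i j; rewrite !mxE rmorphMn /= map_sgn. Qed.

Lemma map_lowmx : map_mx f (lowmx n l R) = lowmx n l R'.
Proof. by rewrite map_diag_mx; congr diag_mx; apply/rowP => i;
  rewrite !mxE rmorph_nat. Qed.

Lemma map_highmx : map_mx f (highmx n l R) = highmx n l R'.
Proof. by rewrite map_diag_mx; congr diag_mx; apply/rowP => i;
  rewrite !mxE rmorph_nat. Qed.

Lemma map_antidiag d : map_mx f (antidiag R d) = antidiag R' d.
Proof. by apply/matrixP => i j; rewrite !mxE rmorph_nat. Qed.

Lemma map_dual (v : 'cV[R]_n) : map_mx f (dual l v) = dual l (map_mx f v).
Proof. by rewrite /dual map_mxM -map_trmx map_pairing. Qed.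

Lemma map_half_square half (z : 'cV[R]_(n - 2 * l)) :
  f (half_square half z) = half_square (f half) (map_mx f z).
Proof.
rewrite /half_square rmorphM; congr (_ * _).
by rewrite -map_antidiag map_trmx -!map_mxM [RHS]mxE.
Qed.

Lemma map_cofactor_of half (v : 'cV[R]_n) (z : 'cV[R]_(n - 2 * l)) :
  map_mx f (cofactor_of half v z)
    = cofactor_of (f half) (map_mx f v) (map_mx f z).
Proof.
apply/matrixP => i j; rewrite mxE [cofactor_of _ _ _ _ _]mxE [RHS]mxE.
rewrite -map_half_square -map_dual [map_mx f (dual l v) _ _]mxE.
case: ifP => _; first exact: rmorphM.
by case: insub => [k|] /=; rewrite ?mxE ?rmorph0.
Qed.

End BaseChange.

Section ChartTriple.

Variables (R : comNzRingType) (n l : nat) (p half : R).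
Implicit Types (v : 'cV[R]_n) (z : 'cV[R]_(n - 2 * l)).

Definition chart_triple v z : triple R (n + n) :=
  let w := cofactor_of half v z in
  (colspan (graph (modX l p v w)), colspan (graph (modY p v w)),
   colspan (graph (modY p v w) *m v)).

(** The line determines v through the normalization at i0; then row i0 of Y + p is w, whose high
    entries are z. *)
Lemma chart_triple_inj (i0 : 'I_n) v z v' z' : v i0 0 = 1 -> v' i0 0 = 1 ->
  chart_triple v z = chart_triple v' z' -> v = v' /\ z = z'.
Proof.
move=> vi v'i [_ EY EG].
have YE : modY p v (cofactor_of half v z) = modY p v' (cofactor_of half v' z').
  by apply: graph_sub => x; rewrite EY.
have vv : v = v'.
  have : colspan (graph (modY p v' (cofactor_of half v' z')) *m v')
      (graph (modY p v (cofactor_of half v z)) *m v).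
    by rewrite -EG; exists 1%:M; rewrite mulmx1.
  rewrite YE => -[c]; rewrite -mulmxA => /graph_mulI vc.
  have := congr1 (fun w : 'cV_n => w i0 0) vc.
  rewrite vi mxE big_ord1 v'i mul1r => c1.
  by rewrite vc [c]mx11_scalar -c1 mulmx1.
split=> //; rewrite -(mid_cofactor half v z) -(mid_cofactor half v' z').
apply/matrixP => j k; rewrite ![mid _ _ _ _]mxE.
have := congr1 (fun A : 'M_n => A i0 (mid_ord j)) YE.
rewrite /modY !mxE !big_ord1 vi v'i !mul1r => /addIr.
by rewrite !mxE.
Qed.

Lemma extend_chart_triple (R' : comNzRingType) (f : {rmorphism R -> R'}) v z :
  extend_triple f (chart_triple v z) =
    (let w := cofactor_of (f half) (map_mx f v) (map_mx f z) in
     (colspan (graph (modX l (f p) (map_mx f v) w)),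
      colspan (graph (modY (f p) (map_mx f v) w)),
      colspan (graph (modY (f p) (map_mx f v) w) *m map_mx f v))).
Proof.
rewrite /extend_triple /chart_triple /= !extend_colspan.
rewrite map_mxM !map_graph -!/(graph _) /modX /modY.
by rewrite !map_mxB !map_mxM !map_scalar_mx -!map_trmx !map_dual
  map_cofactor_of map_pairing.
Qed.

End ChartTriple.

Section Chart.

Variables (F0 : fieldType) (v0 : valuation F0).
Variables (F : fieldExtType F0) (vF : valuation F) (pi : F).
Hypothesis dimF : \dim {:F} = 2%N.
Hypothesis ramF : forall x : F0, x != 0 -> vF (x%:A) = 2 * v0 x.
Hypothesis hpi : uniformizer vF pi.
Variable pi0 : F0.
Hypothesis pi_sqr : pi ^+ 2 = pi0%:A.
Variables (n : nat) (V : vectType F) (e : n.-tuple V) (l : nat).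
Hypothesis l_le : (l <= n./2)%N.
Variables (bar : 'AEnd(F)) (phi : V -> V -> F).
Hypothesis bar_nontrivial : exists a : F, bar a != a.
Hypothesis phi_split : split_basis bar phi e.
Hypothesis phi_hermitian : hermitian_form bar phi.
Hypothesis two_neq0 : (2%:R : F0) != 0.
Variable i0 : 'I_n.

Local Notation OF := (integers vF).

Variable halfO : OF.
Hypothesis halfOE : 2%:R * halfO = 1.

Lemma l_double_le : (2 * l <= n)%N.
Proof. by have := l_le; have := odd_double_half n; lia. Qed.

Section Points.

Variable R : comAlgType OF.

Local Notation p := ((to_integers vF pi)%:A : R).
Local Notation half := (halfO%:A : R).
Local Notation "M ^R" := (map_mx (in_alg R) M) (at level 8, format "M ^R").

Let he : basis_of {:V} e := phi_split.1.

Lemma two_half : 2%:R * half = 1.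
Proof. by rewrite -(rmorph_nat
  (in_alg R)) -[halfO%:A]/(in_alg R halfO) -rmorphM halfOE rmorph1. Qed.

Let pE : (to_integers vF pi ^+ 2)%:A = p ^+ 2.
Proof. exact: (rmorphXn (in_alg R)). Qed.

Lemma t_lR : (t_l vF pi e l)^R = shift_mx n p.
Proof.
rewrite /t_l (mulpi_mx dimF ramF hpi pi_sqr he l_le
  (half_l_basis dimF hpi he l_le)).
by rewrite map_block_mx !map_mx0 map_mx1 map_scalar_mx /= pE.
Qed.

Lemma t_nlR : (t_nl vF pi e l)^R = shift_mx n p.
Proof.
rewrite /t_nl (mulpi_mx dimF ramF hpi pi_sqr he l_le
  (half_nl_basis dimF hpi he l_le)).
by rewrite map_block_mx !map_mx0 map_mx1 map_scalar_mx /= pE.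
Qed.

Lemma incl_l_nlR : (incl_l_nl vF pi e l)^R
  = incl_mx p (lowmx n l R) (highmx n l R).
Proof.
rewrite (incl_l_nlE dimF ramF hpi pi_sqr he l_le) map_block_mx !map_mxZ.
by rewrite map_lowmx map_highmx /= pE.
Qed.

Lemma incl_nl_lR : (incl_nl_l vF pi e l)^R
  = incl_mx p (highmx n l R) (lowmx n l R).
Proof.
rewrite (incl_nl_lE dimF ramF hpi pi_sqr he l_le) map_block_mx !map_mxZ.
by rewrite map_lowmx map_highmx /= pE.
Qed.

Lemma gramR : (gram vF pi bar phi e l)^R =
  block_mx 0 (pairing n l R) (- pairing n l R) 0.
Proof.
rewrite (gramE dimF ramF hpi pi_sqr he l_le bar_nontrivial phi_split two_neq0
  phi_hermitian).
by rewrite map_block_mx !map_mx0 map_mxN map_pairing.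
Qed.

Lemma modXE (v w : 'cV[R]_n) :
  modX l p v w = (pairing n l R)^T *m (modY p v w)^T *m pairing n l R.
Proof.
rewrite /modX /modY /dual linearB /= !trmx_mul !trmxK tr_scalar_mx.
rewrite mulmxBr mulmxBl mul_mx_scalar -scalemxAl pairing_Vmul ?l_double_le //.
by rewrite scalemx1 !mulmxA.
Qed.

Lemma chart_point_triple (v : 'cV[R]_n) (z : 'cV[R]_(n - 2 * l)) : v i0 0
  = 1 -> admissible p v z ->
  chart pi bar phi e l i0 (chart_triple p half v z).
Proof.
move=> vi vz; rewrite /chart /chart_triple /=; set w := cofactor_of half v z.
have wv : (w^T *m v) 0 0 = 2%:R * p := cofactor_dot l_double_le two_half vz.
have dd : ((dual l v)^T *m dual l w) 0 0 = 2%:R * p.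
  by rewrite dual_dot ?l_double_le // -wv -[in RHS](trmxK v) -trmx_mul [RHS]mxE.
have [C1 C2] := cofactor_inclusions l_double_le two_half vz.
have Y2 : modY p v w *m modY p v w = (p ^+ 2)%:M by apply: rank1_sqr.
have X2 : modX l p v w *m modX l p v w = (p ^+ 2)%:M by apply: rank1_sqr.
have detY : \det (modY p v w - p%:M) = 0.
  by apply: (@det_eq0_kernel _ _ _ v i0 1); rewrite ?vi ?mulr1 // rank1_kernel.
(* The kernel vector M^T w of X - p need not have a unit entry. The transpose of X - p kills M^T v,
   whose entry at [flip l i0] is a sign. *)
have detX : \det (modX l p v w - p%:M) = 0.
  rewrite -det_tr; apply: (@det_eq0_kernel _ _ _ (dual l v) (flip l i0)
    (sgn l R i0)).
    by rewrite dualE ?l_double_le // flipK ?l_double_le // vi mulr1 sgn_sqr.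
  rewrite !linearB /= trmx_mul trmxK tr_scalar_mx rank1_kernel //.
  by rewrite dual_dot ?l_double_le.
have n0 : (0 < n)%N by case: (n) i0 => [[]|].
have Ychar := shift_char_poly n0 wv.
have Xchar := shift_char_poly n0 dd.
split; first 1 last.
- by exists (modX l p v w).
- by exists (modY p v w).
- by exists (modY p v w *m v), v; split=> // x; rewrite graph_mul.
split.
- split; rewrite ?t_lR ?t_nlR.
  + split; rewrite ?t_lR ?t_nlR ?incl_l_nlR ?incl_nl_lR ?gramR //.
    * by split; apply: colspan_submodule.
    * by split=> _ [c ->]; rewrite mulmxA shift_graph // -mulmxA; eexists.
    * by split; apply: graph_local_summand.
    split=> //; first by split; apply/incl_graph.
    move=> x; rewrite modXE gram_graph ?pairing_mulV ?l_double_le //.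
    have P1 := pairing_mulV l_double_le R.
    by rewrite !trmx_mul !trmxK !mulmxA P1 mul1mx -mulmxA P1 mulmx1.
  + exact: shift_wedge_top.
  + exact: shift_wedge2.
  + exact: shift_wedge_top.
  + exact: shift_wedge2.
- exact: colspan_submodule.
- exact: vector_local_summand vi.
- move=> _ [c ->]; rewrite t_nlR mulmxA shift_graphD // subrK.
  by exists (w^T *m c); rewrite !mulmxA.
- move=> _ [c ->]; rewrite t_nlR mulmxA mulmxA shift_graphB // -(mulmxA
    (graph _)).
  by rewrite rank1_kernel // mulmx0 mul0mx.
Qed.

Lemma chart_point_ex Fl Fnl G : chart_point pi bar phi e l i0 Fl Fnl G ->
  exists (v : 'cV[R]_n) (z : 'cV[R]_(n - 2 * l)),
    [/\ v i0 0 = 1, admissible p v z & (Fl, Fnl, G) = chart_triple p half v z].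
Proof.
have predE (N N' : 'cV[R]_(n + n) -> Prop) : (forall x, N x <-> N' x) -> N = N'.
  by move=> NN; apply/funext => x; apply/propext.
case=> -[[naive _ _ _ _] _ _ FG G0] [X /predE FlE] [Y /predE FnlE] [G1 [v [vi
  /predE GE]]].
move: naive FG G0; rewrite {}FlE {}FnlE {}GE.
rewrite -[col_mx X 1%:M]/(graph X) -[col_mx Y 1%:M]/(graph Y).
case=> [_ [_ tY] _ [[CX CY] orth _ cY]]; rewrite {}t_nlR in tY cY * => FG G0.
rewrite incl_l_nlR in CX; rewrite incl_nl_lR in CY; rewrite gramR in orth.
have n0 : (0 < n)%N by case: (n) i0 => [[]|].
(* Stability under t: the lower half of the image of the graph is Y, so Y is the coefficient
   matrix. *)
have tYY : shift_mx n p *m graph Y = graph Y *m Y.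
  have /graph_cols : forall j, colspan (graph Y) (col j
    (shift_mx n p *m graph Y)).
    by move=> j; rewrite colE -mulmxA; apply: tY; exists (delta_mx j 0).
  move=> E; rewrite {1}E; congr (_ *m _).
  by rewrite mul_block_col col_mxKd mul1mx mul0mx addr0.
pose w := (row i0 (Y + p%:M))^T.
have YE : Y = modY p v w.
  apply/eqP; rewrite -subr_eq opprK; apply/eqP/matrixP => i j.
  (* The lower half of (t + p) applied to the j-th vector of the graph is column j of Y + p, a
     multiple c of v; its entry at i0 identifies c with w_j. *)
  have [c] : colspan (col_mx G1 v) ((shift_mx n p
    + p%:M) *m (graph Y *m delta_mx j 0)).
    by apply: FG; exists (delta_mx j 0).
  rewrite mulmxDl mulmxA tYY mul_scalar_mx -mulmxA scalemxAr -mulmxDr graph_mul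
    mul_col_mx.
  rewrite -[Y *m _ + _]/(Y *m delta_mx j 0
    + p *: delta_mx j 0) -mul_scalar_mx -mulmxDl.
  move=> /eq_col_mx[_] E.
  have Ec k : (Y + p%:M) k j = v k 0 * c 0 0.
    have := congr1 (fun x : 'cV_n => x k 0) E.
    by rewrite -colE [LHS]mxE [RHS]mxE big_ord1.
  rewrite Ec mxE big_ord1 [w^T _ _]mxE [w _ _]mxE [row _ _ _ _]mxE Ec vi.
  by rewrite mul1r.
(* The trivial localization suffices to read off the characteristic
   polynomial, as F_(n-l) is free. *)
have wv : (w^T *m v) 0 0 = 2%:R * p.
  have loc1 : is_localization (1 : R) (idfun : {rmorphism R -> R}).
    split=> [|y|x /= ->]; first by exists 1; rewrite mulr1.
      by exists y, 0%N; rewrite expr0 mulr1.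
    by exists 0%N; rewrite mulr0.
  have := cY 1 R idfun loc1 (graph Y) Y.
  rewrite extend_colspan !map_mx_id // => /(_ _ tYY) cQ.
  have {cQ} : char_poly Y = ('X + p%:P) ^+ n.-1 * ('X - p%:P).
    rewrite cQ ?map_poly_id //; split=> // c; exact: graph_free.
  rewrite YE /modY char_poly_rank1 //.
  have cE : 'X + p%:P = 'X - (- p)%:P by rewrite polyCN opprK.
  have /monic_lreg creg : ('X + p%:P) ^+ n.-1 \is monic.
    by rewrite monic_exp // cE monicXsubC.
  move/creg/eqP; rewrite -addrA (inj_eq (addrI _)) subr_eq => /eqP E.
  apply: polyC_inj; rewrite rmorphM /= polyC_natr.
  by rewrite mulr_natl mulr2n {1}E addrAC addNr add0r.
have XE : X = modX l p v w.
  have P1 := pairing_mulV l_double_le R; have P2 := pairing_Vmul l_double_le R.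
  have : Y = pairing n l R *m X^T *m (pairing n l R)^T.
    by apply: graph_sub => x /orth; rewrite gram_graph.
  rewrite modXE -YE => ->.
  by rewrite !trmx_mul !trmxK !mulmxA P2 mul1mx -mulmxA P2 mulmx1.
(* The lower half of (t - p) G = 0 says G_1 = p v, while Y v = v (w^T v) - p v = p v. *)
have vE : col_mx G1 v = graph Y *m v.
  have /eqP := G0 (col_mx G1 v) (ex_intro _ 1%:M (esym (mulmx1 _))).
  rewrite mulmxBl mul_block_col mul0mx add0r mul1mx mul0mx addr0 mul_scalar_mx.
  rewrite mul_scalar_mx scale_col_mx opp_col_mx add_col_mx col_mx_eq0 subr_eq0.
  move=> /andP[_]; rewrite subr_eq0 => /eqP ->; rewrite graph_mul; congr col_mx.
  rewrite YE /modY mulmxBl -mulmxA [w^T *m v]mx11_scalar wv mul_mx_scalar.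
  by rewrite mul_scalar_mx -scalerBl mulr_natl mulr2n addrK.
have incl : inclusions l p v w by rewrite /inclusions -XE -YE; split;
  apply/incl_graph.
have vz := inclusions_admissible l_double_le two_half vi wv incl.
exists v, (mid l w); split=> //; rewrite /chart_triple.
by rewrite -(inclusions_factorE l_double_le two_half vi wv incl) -XE -YE vE.
Qed.

End Points.

Lemma extend_chart (R R' : comAlgType OF) (f : {lrmorphism R -> R'})
    (v : 'cV[R]_n) (z : 'cV[R]_(n - 2 * l)) :
  extend_triple f (chart_triple ((to_integers vF pi)%:A) (halfO%:A) v z) =
  chart_triple ((to_integers vF pi)%:A) (halfO%:A) (map_mx f v) (map_mx f z).
Proof. by rewrite extend_chart_triple /= !rmorph_alg. Qed.

(** The chart has been identified with the functor of normalized admissible pairs, so [A] represents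
    it as soon as (v, z) is a universal such pair. *)
Lemma chart_iso_Spec (A : comAlgType OF) (v : 'cV[A]_n) (z : 'cV[A]_(n
  - 2 * l)) :
    v i0 0 = 1 -> admissible ((to_integers vF pi)%:A) v z ->
    (forall (R : comAlgType OF) (h h' : {lrmorphism A -> R}),
      map_mx h v = map_mx h' v -> map_mx h z = map_mx h' z -> h =1 h') ->
    (forall (R : comAlgType OF) (v' : 'cV[R]_n) (z' : 'cV[R]_(n - 2 * l)),
      v' i0 0 = 1 -> admissible ((to_integers vF pi)%:A) v' z' ->
      exists h : {lrmorphism A -> R}, map_mx h v = v' /\ map_mx h z = z') ->
  iso_Spec (@chart _ _ vF pi bar _ V phi e l i0) A.
Proof.
move=> vi vz ext ex.
exists (fun (R : comAlgType OF) (h : {lrmorphism A -> R}) =>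
  chart_triple ((to_integers vF pi)%:A) (halfO%:A) (map_mx h v) (map_mx h z)).
have hvi (R : comAlgType OF) (h : {lrmorphism A ->
  R}) : map_mx h v i0 0 = 1 by rewrite mxE vi rmorph1.
split.
- move=> R h; apply: chart_point_triple (hvi R h) _; have [vz1 vz2] := vz;
    split.
    by move=> i j; have /(congr1 h) := vz1 i j; rewrite !rmorphM !mxE.
  have /(congr1 h) := vz2; rewrite rmorphM rmorph_nat rmorph_sum /= rmorph_alg.
  by move=> <-; apply: eq_bigr => j _; rewrite rmorphM !mxE.
- move=> R h h' E.
  by have [] := chart_triple_inj (hvi R h) (hvi R h') E; apply: ext.
- move=> R [[Fl Fnl] G] /chart_point_ex[v' [z' [vi' vz' ->]]].
  by have [h [<- <-]] := ex R v' z' vi' vz'; exists h.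
- move=> R R' f h; rewrite extend_chart -!map_mx_comp.
  by [].
Qed.

End Chart.

(** * The coordinate rings *)

Lemma minors_map (R R' : comNzRingType) (f : {rmorphism R -> R'}) p q k
    (M : 'M[R]_(p, q)) x :
  minors k M x -> minors k (map_mx f M) (f x).
Proof. by case=> [a [b ->]]; exists a, b; rewrite -map_mxsub det_map_mx. Qed.

Lemma minors2_row_mx (R : comNzRingType) d (a b : 'cV[R]_d) :
  (forall i j, a i 0 * b j 0 = a j 0 * b i 0) <->
  (forall x, minors 2 (row_mx a b) x -> x = 0).
Proof.
split=> [ab x [f [g ->]]|ab i j].
  rewrite det_mx22 !mxE; case: (split (g 0)) => k; case: (split (g 1)) => k';
    rewrite !ord1.
  - by rewrite mulrC subrr.
  - by rewrite ab mulrC subrr.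
  - by rewrite [X in X - _]mulrC ab subrr.
  - by rewrite mulrC subrr.
apply/eqP; rewrite -subr_eq0; apply/eqP/ab.
exists (fun k => if k == 0 then i else j).
exists (fun k => if k == 0 then lshift 1 0 else rshift 1 0).
by rewrite det_mx22 !mxE /= (unsplitK (inl 0)) (unsplitK (inr 0)) [X in _
  = _ - X]mulrC.
Qed.

Lemma map_mid (R R' : comNzRingType) (f : {rmorphism R ->
  R'}) n l (v : 'cV[R]_n) :
  map_mx f (mid l v) = mid l (map_mx f v).
Proof. by apply/matrixP => i j; rewrite !mxE. Qed.

Section CoordinateRings.

Variables (F : fieldType) (vF : valuation F) (pi : F) (hpi : uniformizer vF pi).
Variables (n l : nat) (i0 : 'I_n).

Local Notation OF := (integers vF).
Local Notation piO := (to_integers vF pi).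
Local Notation d := (n - 2 * l)%N.

Lemma admissible_minors (R : comNzRingType) (p : R) (v : 'cV[R]_n)
  (z : 'cV[R]_d) :
  admissible p v z <->
  (forall x, minors 2 (row_mx (mid l v) (antidiag R d *m z)) x -> x = 0) /\
  (z^T *m mid l v) 0 0 = 2%:R * p.
Proof.
have -> : (z^T *m mid l v) 0 0 = \sum_j z j 0 * mid l v j 0.
  by rewrite mxE; apply: eq_bigr => j _; rewrite mxE.
split=> -[vz1 vz2]; split=> //.
  by apply/minors2_row_mx => i j; rewrite !antidiagE.
by move=> i j; rewrite -!antidiagE; apply/minors2_row_mx: i j.
Qed.

Section First.

Local Notation A := (chart_algebra1 hpi l i0).
Local Notation piA := (quotient_map (relations1 hpi l i0)).
Local Notation P := {mpoly OF[n + d]}.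

Let v : 'cV[P]_n := \col_i 'X_(lshift d i).
Let z : 'cV[P]_d := \col_j 'X_(rshift n j).

Definition coordinates1 : 'cV[A]_n := map_mx piA v.
Definition multipliers1 : 'cV[A]_d := map_mx piA z.

Lemma coordinates1_admissible :
  coordinates1 i0 0 = 1 /\ admissible (piO%:A) coordinates1 multipliers1.
Proof.
have rel := @quotient_map_eq0 _ _ (relations1 hpi l i0); split.
  apply/eqP; rewrite -subr_eq0 -(rmorph1 piA) mxE -rmorphB; apply/eqP/rel.
  exact: Or31.
apply/admissible_minors; split=> [x|].
  case=> [f [g ->]]; rewrite -map_mid -(map_antidiag piA) -map_mxM -map_row_mx.
  rewrite -map_mxsub det_map_mx; apply: rel; apply: Or32.
  by exists f, g.
rewrite -map_mid map_trmx -map_mxM mxE -(rmorph_alg piA) -(rmorph_nat piA)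
  -rmorphM.
apply/eqP; rewrite -subr_eq0 -rmorphB; apply/eqP/rel/Or33.
by rewrite alg_mpolyC rmorphM rmorph_nat.
Qed.

Lemma coordinates1_ext (R : comAlgType OF) (h h' : {lrmorphism A -> R}) :
  map_mx h coordinates1 = map_mx h' coordinates1 ->
  map_mx h multipliers1 = map_mx h' multipliers1 -> h =1 h'.
Proof.
move=> hv hz; apply: mpoly_quotient_ext => i.
case: (split_ordP i) => j ->.
  by have := congr1 (fun c : 'cV_n => c j 0) hv; rewrite !mxE.
by have := congr1 (fun c : 'cV_d => c j 0) hz; rewrite !mxE.
Qed.

Lemma coordinates1_ex (R : comAlgType OF) (v' : 'cV[R]_n) (z' : 'cV[R]_d) :
    v' i0 0 = 1 -> admissible (piO%:A) v' z' ->
  exists h : {lrmorphism A -> R}, map_mx h coordinates1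
    = v' /\ map_mx h multipliers1 = z'.
Proof.
move=> vi /admissible_minors[vz1 vz2].
pose x i := match split i with inl a => v' a 0 | inr b => z' b 0 end.
have xv : map_mx (mpoly_eval x) v = v'.
  apply/matrixP => i j; rewrite !mxE /= mpoly_evalX /x (unsplitK (inl i)).
  by rewrite ord1.
have xz : map_mx (mpoly_eval x) z = z'.
  apply/matrixP => i j; rewrite !mxE /= mpoly_evalX /x (unsplitK (inr i)).
  by rewrite ord1.
have [p|h hX] := @mpoly_quotient_ex _ _ _ (relations1 hpi l i0) x.
  case=> [->|/(minors_map (mpoly_eval x))|->].
  - have E : mpoly_eval x (v i0 0) = 1 by rewrite -vi -xv [RHS]mxE.
    by rewrite rmorphB rmorph1 [X in X - _]E subrr.
  - rewrite map_row_mx map_mxM map_antidiag -/(mid l v) -/v -/z map_mid xv xz.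
    exact: vz1.
  - have E : mpoly_eval x ((z^T *m mid l v) 0 0) = 2%:R * piO%:A.
      by rewrite -vz2 -xz -xv -map_mid map_trmx -map_mxM [RHS]mxE.
    rewrite rmorphB /= mpoly_evalC [X in X
      - _]E -[(2%:R * piO)%:A]/(in_alg R _).
    by rewrite rmorphM rmorph_nat subrr.
by exists h; split; rewrite -?xv -?xz; apply/matrixP => i j; rewrite !mxE hX.
Qed.

End First.

Section Second.

Local Notation A := (chart_algebra2 hpi l i0).
Local Notation piA := (quotient_map (relations2 hpi l i0)).
Local Notation P := {mpoly OF[n + 1]}.

Let v : 'cV[P]_n := \col_i 'X_(lshift 1 i).
Let u : P := 'X_(rshift n 0).
Let z : 'cV[P]_d := u *: (antidiag P d *m mid l v).

Definition coordinates2 : 'cV[A]_n := map_mx piA v.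
Definition multipliers2 : 'cV[A]_d := map_mx piA z.

(** With z = u H V_2 and H symmetric, this turns z^T V_2 = 2p into the relation of the second
    chart. *)
Let dotE (R : comNzRingType) (c : R) (x : 'cV[R]_d) :
  ((c *: (antidiag R d *m x))^T *m x) 0 0 = c * (x^T *m antidiag R d *m x) 0 0.
Proof.
have aT : (antidiag R d)^T = antidiag R d.
  by apply/matrixP => i j; rewrite !mxE -(inj_eq rev_ord_inj) rev_ordK eq_sym.
by rewrite linearZ /= trmx_mul aT -scalemxAl mxE.
Qed.

Lemma coordinates2_admissible :
  coordinates2 i0 0 = 1 /\ admissible (piO%:A) coordinates2 multipliers2.
Proof.
have rel := @quotient_map_eq0 _ _ (relations2 hpi l i0); split.
  apply/eqP; rewrite -subr_eq0 -(rmorph1 piA) mxE -rmorphB; apply/eqP/rel.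
  by left.
split=> [i j|].
  rewrite -map_mid [map_mx _ _ i 0]mxE [map_mx _ _ j 0]mxE ![multipliers2 _
    _]mxE.
  by rewrite ![z _ _]mxE !antidiagE !rev_ordK !rmorphM /=; ring.
transitivity (piA ((z^T *m mid l v) 0 0)).
  rewrite mxE rmorph_sum; apply: eq_bigr => j _.
  by rewrite -map_mid rmorphM /= !mxE.
rewrite dotE -(rmorph_alg piA) -(rmorph_nat piA) -rmorphM.
apply/eqP; rewrite -subr_eq0 -rmorphB; apply/eqP/rel; right.
by rewrite alg_mpolyC rmorphM rmorph_nat.
Qed.

Hypothesis i0_high : (2 * l <= i0)%N.

Let j0_subproof : (i0 - 2 * l < d)%N.
Proof. by have := ltn_ord i0; have := i0_high; lia. Qed.

Let j0 : 'I_d := Ordinal j0_subproof.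

Let mid_j0 : mid_ord j0 = i0.
Proof. by apply: val_inj; rewrite /= subnKC. Qed.

Lemma coordinates2_ext (R : comAlgType OF) (h h' : {lrmorphism A -> R}) :
  map_mx h coordinates2 = map_mx h' coordinates2 ->
  map_mx h multipliers2 = map_mx h' multipliers2 -> h =1 h'.
Proof.
move=> hv hz; apply: mpoly_quotient_ext => i.
case: (split_ordP i) => j ->.
  by have := congr1 (fun c : 'cV_n => c j 0) hv; rewrite !mxE.
(* V_2 has entry 1 at j0, so u is the entry of u H V_2 at the reversed index. *)
have uE : multipliers2 (rev_ord j0) 0 = piA u.
  rewrite mxE [z _ _]mxE antidiagE rev_ordK mxE mid_j0 rmorphM /=.
  by have [] := coordinates2_admissible; rewrite mxE => -> _; rewrite mulr1.
have := congr1 (fun c : 'cV_d => c (rev_ord j0) 0) hz.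
by rewrite [LHS]mxE [RHS]mxE uE ord1.
Qed.

Lemma coordinates2_ex (R : comAlgType OF) (v' : 'cV[R]_n) (z' : 'cV[R]_d) :
    v' i0 0 = 1 -> admissible (piO%:A) v' z' ->
  exists h : {lrmorphism A -> R}, map_mx h coordinates2
    = v' /\ map_mx h multipliers2 = z'.
Proof.
move=> vi vz; have [vz1 _] := vz;
  have [_ vz2] := (admissible_minors _ _ _).1 vz.
pose x (i : 'I_(n + 1)) := match split i with inl a => v' a 0 | inr _ =>
  z' (rev_ord j0) 0 end.
have xv : map_mx (mpoly_eval x) v = v'.
  apply/matrixP => i j; rewrite !mxE /= mpoly_evalX /x (unsplitK (inl i)).
  by rewrite ord1.
have xu : mpoly_eval x u = z' (rev_ord j0) 0.
  by rewrite mpoly_evalX /x (unsplitK (inr 0)).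
(* This is the rank relation between row j0, where V_2 has entry 1, and an arbitrary row. *)
have z'E : z' = z' (rev_ord j0) 0 *: (antidiag R d *m mid l v').
  apply/matrixP => i j; rewrite ord1 mxE antidiagE.
  have := vz1 j0 (rev_ord i);
    rewrite rev_ordK [mid _ _ j0 _]mxE mid_j0 vi mul1r => ->.
  exact: mulrC.
have xz : map_mx (mpoly_eval x) z = z'.
  by rewrite map_mxZ map_mxM map_antidiag map_mid xv /= xu -z'E.
have [p|h hX] := @mpoly_quotient_ex _ _ _ (relations2 hpi l i0) x.
  case=> ->.
  - have E : mpoly_eval x (v i0 0) = 1 by rewrite -vi -xv [RHS]mxE.
    by rewrite rmorphB rmorph1 [X in X - _]E subrr.
  - have E : mpoly_eval x (u * ((mid l v)^T *m antidiag P d *m mid l v) 0 0)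
      = 2%:R * piO%:A.
      by rewrite -dotE -vz2 -xz -xv -map_mid map_trmx -map_mxM [RHS]mxE.
    rewrite rmorphB /= mpoly_evalC [X in X
      - _]E -[(2%:R * piO)%:A]/(in_alg R _).
    by rewrite rmorphM rmorph_nat subrr.
by exists h; split; rewrite -?xv -?xz; apply/matrixP => i j; rewrite !mxE hX.
Qed.

End Second.

End CoordinateRings.

Theorem proposition4p2
    (F0 : fieldType) (v0 : valuation F0) (v0_complete : complete_valuation v0)
    (k : fieldType) (red : {rmorphism integers v0 -> k})
    (red_residue : residue_map red)
    (k_perfect : perfect_field k) (k_char : (2%:R : k) != 0)
    (pi0 : F0) (pi0_uniformizer : uniformizer v0 pi0)
    (F : fieldExtType F0) (F_quadratic : \dim {:F} = 2%N)
    (vF : valuation F)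
    (F_ramified : forall x : F0, x != 0 -> vF (x%:A) = 2 * v0 x)
    (pi : F) (pi_uniformizer : uniformizer vF pi) (pi_sqr : pi ^+ 2 = pi0%:A)
    (bar : 'AEnd(F)) (bar_nontrivial : exists a : F, bar a != a)
    (n : nat) (n_gt3 : (3 < n)%N)
    (V : vectType F) (V_dim : \dim {:V} = n)
    (phi : V -> V -> F) (phi_hermitian : hermitian_form bar phi)
    (e : n.-tuple V) (phi_split : split_basis bar phi e)
    (l : nat) (l_special : strongly_nonspecial n l)
    (i0 : 'I_n) :
  ((i0 < 2 * l)%N ->
     iso_Spec (@chart _ _ vF pi bar _ V phi e l i0)
              (chart_algebra1 pi_uniformizer l i0)) /\
  ((2 * l <= i0)%N ->
     iso_Spec (@chart _ _ vF pi bar _ V phi e l i0)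
              (chart_algebra2 pi_uniformizer l i0)).
Proof.
have [l_le _ _ _] := l_special.
(* The reduction of 2 is nonzero in k, so 2 is a unit of the integers of F0; by ramification its
   valuation in F is 0 too, which makes 1/2 integral there. *)
have [two_neq0 v0_two] : (2%:R : F0) != 0 /\ v0 2%:R = 0.
  have : ~ ((\val (2%:R : integers v0) == 0) || (0 < v0 (\val
    (2%:R : integers v0)))).
    by move/red_residue.2; rewrite rmorph_nat; apply/eqP.
  have := valP (2%:R : integers v0); rewrite rmorph_nat inE /=.
  by case: eqVneq => //= _; case: ltgtP.
have two_alg : (2%:R : F) = (2%:R : F0)%:A by rewrite scaler_nat.
have twoF_neq0 : (2%:R : F) != 0 by rewrite two_alg scaler_eq0 oner_eq0 orbF.
have vF_two : vF 2%:R = 0 by rewrite two_alg F_ramified // v0_two mulr0.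
have vF_half : vF 2%:R^-1 = 0.
  have := valuationM vF twoF_neq0 (invr_neq0 twoF_neq0).
  by rewrite divff // valuation1 vF_two add0r => <-.
have halfE : 2%:R * to_integers vF 2%:R^-1 = 1.
  apply: val_inj; rewrite rmorphM rmorph_nat rmorph1 /= val_to_integers //.
  by rewrite divff.
have iso A v z := @chart_iso_Spec _ _ _ _ _ F_quadratic F_ramified
  pi_uniformizer _ pi_sqr
  _ _ _ _ l_le _ _ bar_nontrivial phi_split phi_hermitian two_neq0 i0 _ halfE A
    v z.
split=> i0l.
  have [vi vz] := coordinates1_admissible pi_uniformizer l i0.
  by apply: iso vi vz _ _; [exact: coordinates1_ext|exact: coordinates1_ex].
have [vi vz] := coordinates2_admissible pi_uniformizer l i0.
by apply: iso vi vz _ _; [exact: coordinates2_ext|exact: coordinates2_ex].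
Qed.
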